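(* Let $T$ be a caterpillar with central path $\mathcal{P}$ and $m_t(T)\ge 6$ such that $T$ is not total pivoted. Assume that every total dense element of $T$ lies in $\mathcal{P}$ and that $T$ has exactly one total dense path. Then $\varphi_t(T)=m_t(T)$.
   Context: A caterpillar is a tree $T$ with a central path $\mathcal{P}$ (the path formed by its non-leaf vertices) such that every leaf is at distance one from $\mathcal{P}$. For a simple graph: elements are vertices and edges; two elements are adjacent if they are adjacent vertices, a vertex and an incident edge, or two distinct edges sharing an endpoint; $N_t(x)$ is the set of elements adjacent to $x$ and $d_t(x)=|N_t(x)|$. With elements ordered by non-increasing total degree $d_t(x_1)\ge d_t(x_2)\ge\cdots$, $m_t(G)=\max\{i:d_t(x_i)\ge i-1\}$. With $m=m_t(G)$, an element $x$ is total dense if $d_t(x)\ge m-1$. A path $\langle w_1,\dots,w_k\rangle$ is a total dense path if $w_2,\dots,w_{k-1}$ are total dense and every edge $(w_i,w_{i+1})$ is total dense; its length $\ell$ is its number of edges. Two paths are adjacent if the last vertex of one equals the first vertex of the other. A caterpillar $T$ with $m=m_t(T)\ge 6$ and exactly $m$ total dense elements is total pivoted if either (1) there is a total dense vertex $u$ with $d(u)=m-2$ having a neighbour $u'$ with $d(u')=2$ that is adjacent to a total dense vertex $v\ne u$; or (2) there are paths $P_1,P_2,Q\subseteq\mathcal{P}$ such that $P_1,P_2$ are the only total dense paths of $T$, each contains exactly three total dense elements, $Q$ has $\ell(Q)\le 1$ and no total dense element, and $Q$ is adjacent to both $P_1$ and $P_2$. A total $k$-colouring is a surjective map from elements to $\{1,\dots,k\}$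 giving adjacent elements different colours; an element $x$ is total b-chromatic if $\mathbf{c}(N_t(x))=\{1,\dots,k\}\setminus\{\mathbf{c}(x)\}$; a total b-chromatic $k$-colouring has a total b-chromatic element in every colour class; $\varphi_t(T)$ is the maximum such $k$. *)

(* Defs.v *)
From mathcomp Require Import all_boot.

Set Implicit Arguments.
Unset Strict Implicit.
Unset Printing Implicit Defensive.

Section Graphs.

Variables (V : finType) (e : rel V).

Definition simple_graph : Prop := symmetric e /\ irreflexive e.

Definition degree (v : V) : nat := #|[set w | e v w]|.

Definition is_leaf (v : V) : bool := degree v == 1.

(* A [ucycle] of length at most 2 is a vertex or an edge walked back and
   forth, hence not a cycle of the simple graph. *)
Definition is_tree : Prop :=
  [/\ 0 < #|V|,
      forall x y : V, connect e x y
    & forall c : seq V, ucycle e c -> size c <= 2].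

(* Paths are nonempty vertex sequences; a path and its reversal are different
   sequences for the same subgraph. *)
Definition gpath (p : seq V) : bool :=
  if p is w :: q then path e w q && uniq p else false.

Definition path_length (p : seq V) : nat := (size p).-1.

Definition same_path (p q : seq V) : bool := (p == q) || (p == rev q).

Definition adjacent_paths (p q : seq V) : Prop :=
  exists w : V,
    (ohead (rev p) = Some w /\ ohead q = Some w) \/
    (ohead (rev q) = Some w /\ ohead p = Some w).

Definition central_path (P : seq V) : Prop :=
  gpath P /\ (forall v : V, (v \in P) = ~~ is_leaf v).

Definition caterpillar (P : seq V) : Prop :=
  [/\ is_tree, central_path P
    & forall v : V, is_leaf v -> exists2 w : V, w \in P & e v w].

Definition is_edge (f : {set V}) : bool :=
  [exists u, exists v, e u v && (f == [set u; v])].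

Definition edge : finType := {f : {set V} | is_edge f}.

Definition element : finType := (V + edge)%type.

Definition tadj (x y : element) : bool :=
  match x, y with
  | inl u, inl v => e u v
  | inl u, inr f => u \in val f
  | inr f, inl u => u \in val f
  | inr f, inr g => (f != g) && (val f :&: val g != set0)
  end.

Definition tnbr (x : element) : {set element} := [set y | tadj x y].

Definition tdeg (x : element) : nat := #|tnbr x|.

Definition tdeg_seq : seq nat := sort geq [seq tdeg x | x : element].

(* [nth 0 tdeg_seq i] is the total degree of the element of rank [i + 1]. *)
Definition m_t : nat :=
  \max_(i < size tdeg_seq | i <= nth 0 tdeg_seq i) i.+1.

Definition total_dense (x : element) : bool := m_t - 1 <= tdeg x.

Definition path_elements (p : seq V) : {set element} :=
  [set x : element | match x with
     | inl v => v \in p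
     | inr f => [exists u, exists v,
                   infix [:: u; v] p && (val f == [set u; v])]
     end].

Definition inner_vertices (p : seq V) : seq V := behead (take (size p).-1 p).

(* A total dense path has at least one edge: on a single vertex the defining
   conditions would be void. *)
Definition is_total_dense_path (p : seq V) : Prop :=
  [/\ gpath p, 0 < path_length p,
      forall v : V, v \in inner_vertices p -> total_dense (inl v)
    & forall f : edge, inr f \in path_elements p -> total_dense (inr f)].

(* Every subpath with an edge of a total dense path satisfies
   [is_total_dense_path] too, so the total dense paths "of the graph", which
   get counted, are the inclusion-maximal ones. *)
Definition total_dense_path (p : seq V) : Prop :=
  is_total_dense_path p /\
  (forall q : seq V, is_total_dense_path q -> infix p q -> q = p).

Definition unique_total_dense_path : Prop :=
  exists2 p : seq V, total_dense_path p &
    forall q : seq V, total_dense_path q -> same_path q p.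

Definition dense_elements : {set element} := [set x | total_dense x].

Definition pivoted_at_vertex : Prop :=
  exists u u' v : V,
    [/\ total_dense (inl u), degree u = m_t - 2, e u u' & degree u' = 2] /\
    [/\ e u' v, total_dense (inl v) & v != u].

Definition pivoted_at_paths (P : seq V) : Prop :=
  exists P1 P2 Q : seq V,
    [/\ [/\ total_dense_path P1, total_dense_path P2, ~~ same_path P1 P2
          & forall p : seq V,
              total_dense_path p -> same_path p P1 || same_path p P2],
        [/\ path_elements P1 \subset path_elements P,
            path_elements P2 \subset path_elements P
          & path_elements Q \subset path_elements P],
        #|path_elements P1 :&: dense_elements| = 3 /\
        #|path_elements P2 :&: dense_elements| = 3,
        [/\ gpath Q, path_length Q <= 1
          & [disjoint path_elements Q & dense_elements]]
      & adjacent_paths Q P1 /\ adjacent_paths Q P2].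

Definition total_pivoted (P : seq V) : Prop :=
  [/\ 6 <= m_t, #|dense_elements| = m_t
    & pivoted_at_vertex \/ pivoted_at_paths P].

Section Colouring.

Variables (k : nat) (c : {ffun element -> 'I_k}).

Definition total_colouring : bool :=
  [forall i, exists x, c x == i] &&
  [forall x, forall y, tadj x y ==> (c x != c y)].

Definition b_chromatic (x : element) : bool :=
  c @: tnbr x == ~: [set c x].

Definition total_b_colouring : bool :=
  total_colouring && [forall i, exists x, (c x == i) && b_chromatic x].

End Colouring.

(* Colourings being surjective, no number of colours above [#|element|] is
   possible. *)
Definition phi_t : nat :=
  \max_(k < #|element|.+1
        | [exists c : {ffun element -> 'I_k}, total_b_colouring c]) k.

End Graphs.

(* Main.v *)
Require Import Defs.
From mathcomp Require Import all_boot zify.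

Set Implicit Arguments.
Unset Strict Implicit.
Unset Printing Implicit Defensive.

(** Put the central path, prolonged by one leaf at each end, on a line: position
    [2i] is its vertex [i] and position [2i+1] the edge from [i] to [i+1].  Two
    elements of the line are adjacent iff their positions differ by at most 2,
    and all other elements are leaves and pendant edges hanging at a vertex.
    Since a leaf avoids only two colours, a total b-chromatic colouring with
    [m] colours amounts to a colouring [c] of the line and, for every vertex
    [i], a set [F i] of colours for the pendant edges at [i].

    Give distinct colours to [m] dense elements: a block of consecutive elements
    of the unique dense path and, if that path is too short, further dense
    vertices, which are pairwise non-adjacent and not adjacent to dense vertices
    of the path.  A chosen edge [i, i+1] needs [F i] and [F (i+1)] to cover all
    colours outside the five positions around it.  In the block one takes
    [F (i+1)] to be the complement of [F i] and of these five colours; if [F 0]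
    contains the right colours, a colour of the block lies in [F i] or not
    according to parity, so that the sizes of the [F i] alternate between two
    values with sum [m - 5], both at most half of [m - 5] rounded up.  At both
    ends of the block the colours still missing are given to the next two
    elements of the line and to the next [F].  The rest of the line is coloured
    greedily outwards: each new position has at most five forbidden colours. *)

(** * Sets of colours of prescribed size, and colours outside a short list *)

Section Fill.
Variable C : finType.
Implicit Types (A B R : {set C}) (s : seq C).

(** Tops up a set of forced colours to the number of pendant edges at a vertex, using only the
    colours allowed there. *)
Definition enlarge A B n := A :|: [set z in take (n - #|A|) (enum (B :\: A))].

Lemma enlargeP A B n : A \subset B -> #|A| <= n <= #|B| ->
  [/\ A \subset enlarge A B n, enlarge A B n \subset B & #|enlarge A B n| = n].
Proof.
move=> sAB /andP[An nB]; split; first exact: subsetUl.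
  rewrite subUset sAB; apply/subsetP=> z; rewrite inE => /mem_take.
  by rewrite mem_enum inE => /andP[].
rewrite cardsU; have -> : A :&: [set z in take (n - #|A|) (enum (B :\: A))] = set0.
  apply/setP=> z; rewrite !inE; apply/negP=> /andP[zA /mem_take].
  by rewrite mem_enum inE zA.
rewrite cards0 cardsE (card_uniqP _) ?take_uniq ?enum_uniq // size_takel.
  by lia.
by rewrite -cardE cardsD (setIidPr sAB); lia.
Qed.

Lemma ex_notin_in R s : size s < #|R| -> exists2 z, z \in R & z \notin s.
Proof.
move=> lt_sR; apply/exists_inP; rewrite -negb_forall_in; apply/negP=> /forall_inP Rs.
have /subset_leq_card : R \subset s by apply/subsetP.
by move=> h; have := leq_trans h (card_size s); rewrite leqNgt lt_sR.
Qed.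

Lemma card_compl A : #|~: A| + #|A| = #|[set: C]|.
Proof. by rewrite addnC cardsC -cardsT. Qed.

Lemma ex_notin s : size s < #|[set: C]| -> exists z, z \notin s.
Proof. by move=> /ex_notin_in[z _]; exists z. Qed.

Lemma card_set_seq s : #|[set z in s]| <= size s.
Proof. by rewrite cardsE; exact: card_size. Qed.

Lemma card_set_uniq s : uniq s -> #|[set z in s]| = size s.
Proof. by move=> /card_uniqP; rewrite cardsE. Qed.

End Fill.

(** * Alternating colour sets along a block *)

(* [x] lists the colours of the vertices (even indices) and edges (odd indices)
   of a block of [q + 2] vertices. *)
Section Chain.
Variables (C : finType) (x : nat -> C) (q : nat) (G : {set C}).
Hypothesis xinj : forall i j, i <= q.*2.+2 -> j <= q.*2.+2 -> x i = x j -> i = j.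

(** Edge [i] has index 2i + 1, and the window reaches two indices to either side. At [i = 0] the
    start truncates to 0, and at [i = q] the index 2q + 3 lies outside the block, so each end costs
    one element. *)
Definition window i : {set C} :=
  [set z in [seq x j | j <- iota i.*2.-1 (5 - (i == 0) - (i == q))]].

Fixpoint chain i := if i is i'.+1 then ~: (chain i' :|: window i') else G.

Lemma mem_window i j : i <= q -> j <= q.*2.+2 ->
  (x j \in window i) = (i.*2 <= j.+1) && (j <= i.*2.+3).
Proof.
move=> iq jq; rewrite inE; apply/mapP/idP => [[k]|h].
  rewrite mem_iota => hk /xinj jk; have {}jk : j = k by apply: jk => //; lia.
  by subst; lia.
by exists j; rewrite // mem_iota; lia.
Qed.

Lemma card_window i : i <= q -> #|window i| = 5 - (i == 0) - (i == q).
Proof.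
move=> iq; rewrite card_set_uniq ?size_map ?size_iota //.
rewrite map_inj_in_uniq ?iota_uniq // => j k.
by rewrite !mem_iota => hj hk; apply: xinj; lia.
Qed.

Hypothesis HG : forall j, j <= q.*2.+2 -> (x j \in G) = ~~ odd j./2 && (4 <= j).

(* The parity pattern: from [i + 2] on, a vertex [j] and the edge after it have
   their colours in [chain i] iff [j] and [i] have the same parity. *)
Lemma chain_mem i j : i <= q.+1 -> j <= q.*2.+2 -> i.*2 <= j.+3 ->
  (x j \in chain i) = (i.*2.+4 <= j) && (odd j./2 == odd i).
Proof.
elim: i j => [|i IH] j iq jq ij /=; first by rewrite HG //; lia.
rewrite inE inE IH ?mem_window //; lia.
Qed.

(** By [chain_mem], a block colour of index at least 2i - 3 lies in [chain i] only if its index is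
    at least 2i + 4, which is past the window. *)
Lemma chain_disj i : i <= q -> chain i :&: window i = set0.
Proof.
move=> iq; apply/setP=> z; rewrite !inE; apply/negP=> /andP[zc /mapP[j]].
rewrite mem_iota => hj zj; move: zc; rewrite zj chain_mem; lia.
Qed.

(** Disjointness turns the complement into a subtraction: neighbouring sizes add up to [m - 5],
    where [m] is the number of colours. The windows at the two ends are shorter by one, so the first
    and the last set are larger by one. *)
Lemma chain_card i : 0 < #|G| -> #|G| + 4 <= #|[set: C]| -> i <= q.+1 ->
  #|chain i| = (if odd i then #|[set: C]| - 4 - #|G| else #|G|.-1)
               + (i == 0) + (i == q.+1).
Proof.
move=> g0 gm; elim: i => [|i IH] iq; first by rewrite /=; lia.
have /= := card_compl (chain i :|: window i).
rewrite cardsU chain_disj ?cards0 // card_window // IH; last by lia.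
by case Oi: (odd i) => /=; lia.
Qed.

(** No window contains such a colour, so every complement moves it to the other side. *)
Lemma chain_out i z : (forall j, j <= q.*2.+2 -> x j != z) -> i <= q.+1 ->
  (z \in chain i) = (z \in G) (+) odd i.
Proof.
move=> zx; elim: i => [|i IH] iq /=; first by rewrite addbF.
rewrite inE inE IH; last by lia.
have -> : z \in window i = false.
  rewrite inE; apply/negP=> /mapP[j]; rewrite mem_iota => hj zj.
  by have := zx j; rewrite zj eqxx => /(_ _)/notF; apply; lia.
by rewrite orbF addbN.
Qed.

End Chain.

Lemma count_parity q : count (fun j => ~~ odd j./2 && (4 <= j)) (iota 0 q.*2.+3) = q.
Proof.
have -> : q.*2.+3 = 3 + q.*2 by lia.
rewrite iotaD count_cat; set f := count _; have -> : f (iota 0 3) = 0 by [].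
(* From index 3 on, an odd index and its successor contain exactly one index that fits the
   pattern. *)
rewrite add0n {}/f; elim: q => [//|q IH]; have -> : q.+1.*2 = q.*2 + 2 by lia.
by rewrite iotaD count_cat IH /=; lia.
Qed.

(* In the exceptional case [eR] cannot be put on its preferred side because
   [eL] already fills the half of [E] in question. *)
Lemma split_extra (C : finType) (E : {set C}) (eL eR : C) (lam rho par : bool) :
  (lam -> eL \in E) -> (rho -> eR \in E) -> (lam -> rho -> eL != eR) ->
  exists X : {set C}, [/\ X \subset E, #|X|.*2 <= #|E|.+1,
    #|E| <= #|X|.*2.+1, lam -> eL \in X
  & rho -> (eR \in X) = par \/ [/\ lam, par & #|E| = 2]].
Proof.
move=> EL ER LR.
have E1 : lam || rho -> 0 < #|E|.
  by rewrite card_gt0 => /orP[/EL|/ER] zE; apply/set0Pn; eexists; exact: zE.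
(* [Bi] is forced into [X] and [Bo] out of it. If [E] has just two elements, [eL] and [eR] together
   exceed the allowed size, so [eR] is then not forced in. *)
pose exc := [&& lam, rho & #|E| == 2].
pose Bi := (if lam then [set eL] else set0) :|:
           (if [&& rho, par & ~~ exc] then [set eR] else set0).
pose Bo := if rho && ~~ par then [set eR] else set0.
have sub1 : Bi \subset E :\: Bo.
  apply/subsetP=> z; rewrite /Bi /Bo inE => /orP[]; case: ifP; rewrite ?inE //.
    move=> l /eqP->; rewrite EL // andbT; case: ifP => [/andP[r _]|];
      by rewrite inE // LR.
  case/and3P=> r pa _ /eqP->; rewrite ER // andbT.
  by rewrite r pa inE.
have cBi : #|Bi| <= lam + [&& rho, par & ~~ exc].
  rewrite /Bi; apply: leq_trans (leq_card_setU _ _) _.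
  by apply: leq_add; case: ifP; rewrite ?cards1 ?cards0.
have cBo : #|E :\: Bo| = #|E| - (rho && ~~ par).
  rewrite cardsD /Bo; case: ifP => [/andP[/ER eE _]|]; last by rewrite setI0 cards0.
  by rewrite (setIidPr _) ?cards1 // sub1set.
have E2 : lam && rho -> 2 <= #|E|.
  case/andP=> l r; have /subset_leq_card : [set eL; eR] \subset E.
    by apply/subsetP=> z; rewrite !inE => /orP[]/eqP->; [exact: EL|exact: ER].
  by rewrite cards2 LR.
(* Half of [E] rounded down, or one more if the forced elements need it. *)
have [|sX Xs cX] := enlargeP (n := maxn #|Bi| #|E|./2) sub1.
  have := subset_leq_card sub1; rewrite cBo; move: #|Bi| #|E| E1; clear.
  by move=> b n; case: rho; case: par; rewrite ?orbT /= => H; try have := H isT; lia.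
exists (enlarge Bi (E :\: Bo) (maxn #|Bi| #|E|./2)); rewrite cX; split=> //.
- by apply: subset_trans Xs _; exact: subsetDl.
- rewrite /exc in cBi; move: #|Bi| #|E| cBi E1 E2; clear => b n.
  case: lam; case: rho; case: par; case: (n =P 2) => //= [->|n2] H H1 H2;
    try have := H1 isT; try have := H2 isT; lia.
- by clear; lia.
- by move=> l; apply: (subsetP sX); rewrite /Bi l !inE eqxx.
move=> r; case ex: exc; case pa: par.
- by right; move/and3P: ex => [-> _ /eqP].
- left; apply/negP=> /(subsetP Xs); by rewrite /Bo r pa !inE eqxx.
- by left; apply: (subsetP sX); rewrite /Bi r pa ex !inE eqxx orbT.
left; apply/negP=> /(subsetP Xs); by rewrite /Bo r pa !inE eqxx.
Qed.

(** * Colouring one block of the line *)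

Section Middle.
Variables (C : finType) (lam rho : bool) (L : nat -> nat) (YL YR : {set C}).
Local Notation m := #|[set: C]|.
(** The bounds below determine [h] as half of [m - 5] rounded up. *)
Variable h : nat.
Hypotheses (m6 : 6 <= m) (h_lb : m - 5 <= h.*2) (h_ub : h.*2 <= m - 4).

Definition seq_set (y : nat -> C) a n : {set C} := [set z in map y (iota a n)].

Lemma seq_setP (y : nat -> C) a n z :
  reflect (exists2 j, a <= j < a + n & z = y j) (z \in seq_set y a n).
Proof.
rewrite inE; apply: (iffP idP) => [/mapP[j]|[j hj ->]].
  by rewrite mem_iota; exists j.
by apply: map_f; rewrite mem_iota.
Qed.

(* Here the block has [p] vertices; [y] starts with the edge entering it
   (index 0) and ends with the edge leaving it (index [2p]), so that vertex [i]
   has index [2i+1].  [YL] and [YR] hold the colour of the isolated chosen vertex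
   two steps away from the block, if there is one; having it in [F] keeps it away
   from the elements coloured in [end_extension]. *)
Definition path_solution p (y : nat -> C) (F : nat -> {set C}) :=
  [/\ forall i, i < p -> [/\ #|F i| = L i, y i.*2 \notin F i,
        y i.*2.+1 \notin F i & y i.*2.+2 \notin F i],
      forall i, i < p -> (0 < i -> y i.*2.-1 \notin F i) /\
                         (i.+1 < p -> y i.*2.+3 \notin F i),
      forall i, i.+1 < p -> F i :|: F i.+1 :|: seq_set y i.*2 5 = setT,
      YL \subset F 0 /\ YR \subset F p.-1
    & [/\ y 0 \notin [:: y 1; y 2], y p.*2 \notin [:: y p.*2.-1; y p.*2.-2],
          1 < p -> y 0 != y 3 & 1 < p -> y p.*2 != y p.*2.-1.-2]].

(* Colours outside the block have no prescribed parity: they are split evenly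
   by [split_extra], with [eL] in the first and, if possible, [eR] in the last
   set of the chain, since the end edges need not be repeated there. *)
Lemma chain_seed (y0 : nat -> C) q : let p := q.+2 in let x j := y0 j.+1 in
  {in [pred j | ~~ lam <= j < p.*2 + rho] &, injective y0} ->
  exists (G : {set C}) (eL eR : C),
  [/\ forall j, j <= q.*2.+2 -> (x j \in G) = ~~ odd j./2 && (4 <= j),
      forall i, i <= q.+1 -> #|chain x q G i| <= h + (i == 0) + (i == q.+1),
      eL \in G /\ (lam -> eL = y0 0), rho -> eR = y0 p.*2 &
      eR \in chain x q G q.+1 \/ [/\ lam, rho & m = p.*2.+1]].
Proof.
move=> p x y0inj.
have xinj i j : i <= q.*2.+2 -> j <= q.*2.+2 -> x i = x j -> i = j.
  by move=> hi hj /y0inj; rewrite !inE /p => H; apply: succn_inj; apply: H; clear -hi hj; lia.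
pose xs := [seq x j | j <- iota 0 q.*2.+3].
have xsP j : j <= q.*2.+2 -> x j \in xs by move=> jq; apply: map_f; rewrite mem_iota; clear -jq; lia.
pose E : {set C} := ~: [set z in xs].
have cE : #|E| + q.*2.+3 = m.
  rewrite -(card_compl [set z in xs]) card_set_uniq ?size_map ?size_iota //.
  rewrite map_inj_in_uniq ?iota_uniq // => j k.
  by rewrite !mem_iota => hj hk; apply: xinj; clear -hj hk; lia.
have EP z : reflect (forall j, j <= q.*2.+2 -> x j != z) (z \in E).
  rewrite in_setC in_set; apply: (iffP idP) => [H j jq|H].
    by apply: contraNneq H => <-; exact: xsP.
  apply/negP=> /mapP[j]; rewrite mem_iota => hj zj.
  by have /eqP[] : x j != z by apply: H; clear -hj; lia.
have EL : lam -> y0 0 \in E.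
  move=> l; apply/EP=> j jq; apply/eqP=> /y0inj; rewrite !inE l => H.
  by have : j.+1 = 0 by apply: H; rewrite ?/p; clear -jq; lia.
have ER : rho -> y0 p.*2 \in E.
  move=> r; apply/EP=> j jq; apply/eqP=> /y0inj; rewrite !inE r => H.
  have : j.+1 = p.*2 by apply: H; rewrite /p; clear -jq; lia.
  by rewrite /p; clear -jq; lia.
have LR : lam -> rho -> y0 0 != y0 p.*2.
  move=> l r; apply/eqP=> /y0inj; rewrite !inE l r => H.
  by have : 0 = p.*2 by apply: H; rewrite /p; clear; lia.
(* The last set of the chain has index [q.+1]; by [chain_out] an extra colour lies in it iff its
   membership in [X] agrees with [odd q]. *)
have [X [sX cX cEX XL XR]] := split_extra (odd q) EL ER LR.
pose par j := ~~ odd j./2 && (4 <= j).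
pose ps := [seq x j | j <- iota 0 q.*2.+3 & par j].
pose G := X :|: [set z in ps].
have psP j : j <= q.*2.+2 -> (x j \in ps) = par j.
  move=> jq; apply/mapP/idP => [[k]|pj]; last first.
    by exists j; rewrite // mem_filter pj mem_iota; lia.
  rewrite mem_filter mem_iota => /andP[pk kq] /xinj jk.
  have kq2 : k <= q.*2.+2 by clear -kq; lia.
  by rewrite (jk jq kq2).
have cG : #|G| = #|X| + q.
  rewrite cardsU disjoint_setI0; last first.
    rewrite disjoint_subset; apply/subsetP=> z /(subsetP sX)/EP zx.
    rewrite inE in_set; apply/negP=> /mapP[j]; rewrite mem_filter mem_iota => /andP[_ jq] zj.
    by have /eqP[] : x j != z by apply: zx; clear -jq; lia.
  rewrite cards0 subn0 card_set_uniq ?size_map ?size_filter ?count_parity //.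
  rewrite map_inj_in_uniq ?filter_uniq ?iota_uniq // => j k.
  by rewrite !mem_filter !mem_iota => /andP[_ hj] /andP[_ hk]; apply: xinj; clear -hj hk; lia.
have HG j : j <= q.*2.+2 -> (x j \in G) = ~~ odd j./2 && (4 <= j).
  move=> jq; rewrite in_setU [in X in _ || X]in_set psP // orb_idl // => /(subsetP sX)/EP.
  by move/(_ j jq); rewrite eqxx.
have GE z : z \in E -> (z \in G) = (z \in X).
  move=> /EP zx; rewrite in_setU in_set orb_idr // => /mapP[j].
  rewrite mem_filter mem_iota => /andP[_ jq] zj.
  by have /eqP[] : x j != z by apply: zx; clear -jq; lia.
have hq := chain_card xinj HG.
have G0 : 0 < #|G| by have := subset_leq_card sX; clear -cG cE cX cEX m6; lia.
have G4 : #|G| + 4 <= m by have := subset_leq_card sX; clear -cG cE cX cEX m6; lia.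
have {}hq i := hq i G0 G4.
have [eL eLG eLy] : exists2 eL, eL \in G & lam -> eL = y0 0.
  case l: lam EL XL => EL XL; first by exists (y0 0); rewrite // GE ?XL ?EL.
  by move: G0; rewrite card_gt0 => /set0Pn[z zG]; exists z.
have [eR eRy eRG] : exists2 eR, rho -> eR = y0 p.*2 &
    eR \in chain x q G q.+1 \/ [/\ lam, rho, odd q & #|E| = 2].
  case r: rho ER XR => ER XR.
    exists (y0 p.*2) => //; case: (XR isT) => [XR1|[]]; last by right.
    by left; rewrite (chain_out _ (EP _ (ER isT))) // GE ?ER // XR1 /=; case: odd.
  (* Without a chosen edge on the right, any member of the last set can serve as [eR]. *)
  have : 0 < #|chain x q G q.+1| by rewrite hq //; clear -G0 G4; lia.
  by rewrite card_gt0 => /set0Pn[z zG]; exists z => //; left.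
exists G, eL, eR; split=> //.
  move=> i iq; rewrite hq //; clear -cE cX cEX cG G4 h_lb h_ub.
  by case: odd; lia.
case: eRG => [|[l r _ E2]]; [by left|right; split=> //].
by clear -cE E2; rewrite /p; lia.
Qed.

(** [F i] is [chain i] without the colours near vertex [i], filled up to [L i] elements. The first
    and the last set of the chain may be one too large, but lose [eL] and [eR] in this way. A
    removed colour belongs to vertex [i] itself or to one of the two line edges at it, which lie in
    the windows of all block edges at [i]; hence the covering of all colours survives. *)
Lemma path_solution_many (y0 : nat -> C) q : let p := q.+2 in
  {in [pred j | ~~ lam <= j < p.*2 + rho] &, injective y0} ->
  (forall i, i < p -> h <= L i <= m - 5) ->
  #|YL| + h <= L 0 -> #|YR| + h <= L p.-1 ->
  (forall j, j <= 3 -> if lam then y0 j \notin YL else YL == set0) ->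
  (forall j, p.*2 - 3 <= j <= p.*2 -> if rho then y0 j \notin YR else YR == set0) ->
  (lam -> rho -> m = p.*2.+1 -> #|YR| + h < L p.-1) ->
  exists y F, (forall j, ~~ lam <= j < p.*2 + rho -> y j = y0 j) /\
    path_solution p y F.
Proof.
move=> p y0inj hL hYL hYR disL disR hexc.
have [G [eL [eR [HG hq [eLG eLy] eRy eRG]]]] := chain_seed y0inj.
rewrite -/p in eRy eRG; pose x j := y0 j.+1.
rewrite -/x in HG hq eRG.
have xinj i j : i <= q.*2.+2 -> j <= q.*2.+2 -> x i = x j -> i = j.
  by move=> hi hj /y0inj; rewrite !inE /p => H; apply: succn_inj; apply: H; clear -hi hj; lia.
have cm := chain_mem xinj HG.
pose y j := if j == 0 then eL else if j == p.*2 then eR else y0 j.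
have yx j : j <= q.*2.+2 -> y j.+1 = x j by move=> jq; rewrite /y ifF //; clear -jq; rewrite /p; lia.
have yy0 j : ~~ lam <= j < p.*2 + rho -> y j = y0 j.
  rewrite /y; case: eqP => [-> |_]; first by case: lam eLy => // /(_ isT).
  by case: eqP => // ->; case: rho eRy => [/(_ isT) -> //|_]; clear; lia.
pose av i := seq_set y i.*2.-1 (5 - (i == 0) - (i == q.+1)).
pose base i := (chain x q G i :\: av i) :|: (if i == 0 then YL else set0)
               :|: (if i == q.+1 then YR else set0).
pose F i := enlarge (base i) (~: av i) (L i).
have sb i : i < p -> base i \subset ~: av i.
  move=> ip; rewrite !subUset subsetDr /=; apply/andP; split.
    case: eqP => [i0|_]; last exact: sub0set.
    rewrite subsetC; apply/subsetP=> z /seq_setP[j hj ->]; rewrite inE.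
    have j3 : j <= 3 by clear -hj i0; lia.
    have := disL _ j3; case: ifP => [l|_ /eqP->]; last by rewrite inE.
    by rewrite yy0 // l; clear -j3; rewrite /p; lia.
  case: eqP => [i0|_]; last exact: sub0set.
  rewrite subsetC; apply/subsetP=> z /seq_setP[j hj ->]; rewrite inE.
  have j3 : p.*2 - 3 <= j <= p.*2 by clear -hj i0; rewrite /p; lia.
  have := disR _ j3; case: ifP => [l|_ /eqP->]; last by rewrite inE.
  by rewrite yy0 // l; clear -j3; rewrite /p in j3 *; lia.
have cb i : i < p -> #|base i| <= L i.
  move=> ip; rewrite /base.
  apply: leq_trans (leq_card_setU _ _) _.
  apply: leq_trans (leq_add (leq_card_setU _ _) (leqnn _)) _.
    have hD : #|chain x q G i :\: av i| <= #|chain x q G i| by exact: subset_leq_card (subsetDl _ _).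
  have hDz z : z \in chain x q G i -> z \in av i -> #|chain x q G i :\: av i| < #|chain x q G i|.
    move=> zc za; apply: proper_card; apply/properP; split; first exact: subsetDl.
    by exists z; rewrite // inE za.
  case: (eqVneq i 0) => [i0|i0].
    have := hDz eL; rewrite i0 /= cards0 eLG => /(_ isT)H.
    have {}H : #|G :\: av 0| < #|G|.
      by apply: H; apply/seq_setP; exists 0.
    by have := hq 0 isT; rewrite /= in H *; clear -H hYL; lia.
  case: (eqVneq i q.+1) => [i1|i1]; last first.
    have := hq i ip; rewrite !cards0 (negPf i0) (negPf i1) => H.
    by have := leq_trans hD H; have /andP[] := hL i ip; clear; lia.
  rewrite cards0; case: eRG => [eRc|[l r E2]].
    have := hDz eR; rewrite i1 eRc => /(_ isT)H.
    have {}H : #|chain x q G q.+1 :\: av q.+1| < #|chain x q G q.+1|.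
      by apply: H; apply/seq_setP; exists p.*2; rewrite /p; [clear; lia|rewrite /y eqxx].
    have := hq _ (leqnn q.+1); rewrite eqxx -/x => H2.
    by have := leq_trans H H2; move: hYR; rewrite (_ : p.-1 = q.+1) //; clear; lia.
  (* In the exceptional case [eR] need not lie in the last set, and the strict bound on [L] makes
     room for the surplus element. *)
  have := hexc l r E2; have := hq _ (leqnn q.+1); rewrite i1 in hD *.
  rewrite eqxx (_ : p.-1 = q.+1) //; move: hD; move: #|chain _ _ _ _| => cc; clear; lia.
have FP i : i < p -> [/\ base i \subset F i, F i \subset ~: av i & #|F i| = L i].
  move=> ip; apply: enlargeP; [exact: sb|rewrite cb //=].
  have := card_compl (av i); have : #|av i| <= 5.
    by apply: leq_trans (card_set_seq _) _; rewrite size_map size_iota; clear; lia.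
  by have := hL i ip; clear -m6; lia.
have Fav i j : i < p -> i.*2.-1 <= j < i.*2.-1 + (5 - (i == 0) - (i == q.+1)) -> y j \notin F i.
  move=> ip hj; have [_ /subsetP sF _] := FP i ip; apply/negP=> /sF.
  by rewrite in_setC => /negP[]; apply/seq_setP; exists j.
exists y, F; split => //; split.
- move=> i ip; have [_ _ ->] := FP i ip; split=> //; apply: Fav => //; clear -ip; rewrite /p in ip; lia.
- move=> i ip; split=> h0; apply: Fav => //; clear -ip h0; rewrite /p in ip h0 *; lia.
- move=> i ip; apply/setP=> z; rewrite in_setT.
  have ip' : i < p by clear -ip; lia.
  have [/subsetP bF _ _] := FP _ ip'; have [/subsetP bF1 _ _] := FP _ ip.
  have chav k : k < p -> z \in chain x q G k -> z \in F k \/ exists2 j, k.*2 <= j <= k.*2.+2 & z = y j.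
    move=> kp zk; case za: (z \in av k); last first.
      left; have [/subsetP bk _ _] := FP _ kp; apply: bk.
      by rewrite /base !in_setU in_setD za zk.
    right; have /seq_setP[j hj zj] := za; exists j => //.
    have jk : [|| k.*2 <= j <= k.*2.+2 | [&& 0 < j, j.-1 <= q.*2.+2, k.*2 <= j.-1.+3 & j.-1 < k.*2.+4]].
      by clear -hj kp; rewrite /p in kp; lia.
    case/orP: jk => // /and4P[j0 jq kj jk];
    have := cm k j.-1 kp jq kj; rewrite -yx // prednK // -zj zk => /esym/andP[].
    by move=> kj2; move: jk; rewrite ltnNge kj2.
  have inw j : i.*2 <= j <= i.*2.+4 -> z = y j -> z \in seq_set y i.*2 5.
    by move=> hj zj; apply/seq_setP; exists j => //; clear -hj; lia.
  rewrite 2!in_setU; case zi: (z \in chain x q G i).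
    case: (chav i ip' zi) => [->//|[j hj /inw->]]; rewrite ?orbT //; clear -hj; lia.
  case zw: (z \in window x q i).
    move: zw; rewrite in_set => /mapP[j]; rewrite mem_iota -/(x j) => hj.
    rewrite -yx; last by clear -hj ip; rewrite /p in ip; lia.
    by move=> /inw->; rewrite ?orbT //; clear -hj; lia.
  have zi1 : z \in chain x q G i.+1 by rewrite /= in_setC in_setU zi zw.
  case: (chav i.+1 ip zi1) => [->//|[j hj /inw->]]; rewrite ?orbT //; clear -hj; lia.
- have [/subsetP b0 _ _] := FP 0 isT; have [/subsetP b1 _ _] := FP q.+1 (ltnSn _).
  by split; apply/subsetP=> z zY; [apply: b0|apply: b1]; rewrite /base !in_setU ?eqxx zY ?orbT.
have HL j : j <= 2 -> y 0 != y j.+1.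
  move=> j2; have jq : j <= q.*2.+2 by clear -j2; lia.
  apply/eqP=> eLj; have := cm 0 j isT jq isT; rewrite -yx // -eLj [y 0]/y eqxx eLG.
  by move/esym/andP=> []; clear -j2; lia.
have HR j : q.*2 <= j <= q.*2.+2 -> y p.*2 != y j.+1.
  move=> j2; have jq : j <= q.*2.+2 by clear -j2; lia.
  have -> : y p.*2 = eR by rewrite /y eqxx.
  rewrite yx //; apply/eqP=> eRj; case: eRG => [|[l r _]].
    have jq3 : q.+1.*2 <= j.+3 by clear -j2; lia.
    by rewrite eRj cm //; clear -j2; lia.
  (* In the exceptional case [eR] is the colour of a chosen edge, and injectivity of [y0] separates
     it from the block. *)
  move: eRj; rewrite eRy // => /y0inj; rewrite !inE l r => H.
  have {H} : p.*2 = j.+1 by apply: H; clear -jq; rewrite /p; lia.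
  by clear -jq; rewrite /p; lia.
by rewrite !inE !negb_or !HL // !HR //; rewrite -/(double q); clear; lia.
Qed.

(** A single vertex has no inner edge to cover: any set of the right size works that contains [YL]
    and [YR] and avoids the three elements at the vertex. *)
Lemma path_solution_vertex (y0 : nat -> C) :
  {in [pred j | ~~ lam <= j < 2 + rho] &, injective y0} ->
  L 0 <= m - 5 -> h <= L 0 -> #|YL| <= 1 -> #|YR| <= 1 ->
  #|YL| + h <= L 0 -> #|YR| + h <= L 0 ->
  (if lam then forall j, j < 2 + rho -> y0 j \notin YL else YL == set0) ->
  (if rho then forall j, ~~ lam <= j <= 2 -> y0 j \notin YR else YR == set0) ->
  exists y F, (forall j, ~~ lam <= j < 2 + rho -> y j = y0 j) /\
    path_solution 1 y F.
Proof.
move=> y0inj Lm Lh YL1 YR1 hYL hYR disL disR.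
(* Since [m >= 6], [h] is positive and leaves room for the colour in [YR]. *)
have cY : #|YL :|: YR| <= L 0.
  by apply: leq_trans (leq_card_setU _ _) _; clear disL disR; lia.
have [eL eL1 eLy] : exists2 eL, [/\ eL != y0 1, rho -> eL != y0 2 & eL \notin YR]
    & lam -> eL = y0 0.
  case l: lam y0inj disR => y0inj disR.
    exists (y0 0) => //; split.
    - by apply/eqP=> /y0inj; rewrite !inE /= => H; have := H isT isT.
    - by move=> r; apply/eqP=> /y0inj; rewrite !inE r /= => H; have := H isT isT.
    - by move: disR; case: (rho) => [|/eqP->]; [exact|rewrite inE].
  have [|z] := @ex_notin C (y0 1 :: y0 2 :: enum YR).
    by rewrite /= -cardE; clear -m6 YR1; lia.
  by rewrite !inE mem_enum !negb_or => /and3P[]; exists z.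
have {}eL1 : [/\ eL != y0 1, rho -> eL != y0 2 & eL \notin YR] by [].
have [eR eR1 eRy] : exists2 eR, [/\ eR != y0 1, eR != eL & eR \notin YL]
    & rho -> eR = y0 2.
  case: eL1 => eL1 eL2 eL3; case r: rho y0inj disL eL2 => y0inj disL eL2.
    exists (y0 2) => //; split.
    - by apply/eqP=> /y0inj; rewrite !inE /= => H; have := H _ _; case: lam => /(_ isT isT).
    - by rewrite eq_sym eL2.
    - by move: disL; case: (lam) => [|/eqP->]; [exact|rewrite inE].
  have [|z] := @ex_notin C (y0 1 :: eL :: enum YL).
    by rewrite /= -cardE; clear -m6 YL1; lia.
  by rewrite !inE mem_enum !negb_or => /and3P[]; exists z.
case: eL1 eR1 => eL1 _ eLR [eR1 eRL eRLY].
pose y j := if j == 0 then eL else if j == 2 then eR else y0 j.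
have yy0 j : ~~ lam <= j < 2 + rho -> y j = y0 j.
  rewrite /y; case: eqP => [-> |_]; first by case: lam eLy => // /(_ isT).
  by case: eqP => // ->; case: rho eRy => [/(_ isT) -> //|_]; clear; lia.
pose B := ~: [set z in [:: eL; y0 1; eR]].
have sY : YL :|: YR \subset B.
  rewrite subUset; apply/andP; split; rewrite subsetC; apply/subsetP=> z;
    rewrite !inE => /or3P[]/eqP-> //.
  - by move: disL; case: ifP => [l|_ /eqP->]; rewrite ?inE // eLy //; exact.
  - by move: disL; case: ifP => [l|_ /eqP->]; rewrite ?inE //; exact.
  - move: disR; case: ifP => [l|_ /eqP->]; rewrite ?inE //; apply; by case: lam.
  - by move: disR; case: ifP => [l|_ /eqP->]; rewrite ?inE // eRy //; apply; case: lam.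
have cB : L 0 <= #|B|.
  have := card_compl [set z in [:: eL; y0 1; eR]]; have := card_set_seq [:: eL; y0 1; eR].
  by rewrite -/B /=; clear -Lm m6; lia.
have [|bF Fb cF] := enlargeP (n := L 0) sY; first by rewrite cY cB.
have FN z : z \in [:: eL; y0 1; eR] -> z \notin enlarge (YL :|: YR) B (L 0).
  by move=> zl; apply/negP=> /(subsetP Fb); rewrite in_setC in_set zl.
exists y, (fun=> enlarge (YL :|: YR) B (L 0)); split=> //; split.
- by case=> // _; rewrite cF; split=> //; apply: FN; rewrite /y /= !inE eqxx ?orbT.
- by case.
- by [].
- by split; apply: subset_trans bF; [exact: subsetUl|exact: subsetUr].
by rewrite /y /= !inE !negb_or eL1 eR1 eRL eq_sym eRL.
Qed.
End Middle.

(** * Extending a colouring past the ends of the block *)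

(* [e0, v1, e1] are the outer edge, the last vertex and the inner edge at one end
   of the block, [v0] and [e'] the next vertex and edge outwards.  If [b], then
   [e0] is a chosen edge, and [e'], [v0] and [F'] must supply the missing colours. *)
Lemma end_extension (C : finType) (b : bool) (F : {set C}) (e0 v1 e1 z : C) (Y : {set C}) n :
  6 <= #|[set: C]| -> #|F| <= #|[set: C]| - 5 -> #|Y| <= 1 ->
  uniq [:: e0; v1; e1] -> e0 \notin F -> v1 \notin F -> e1 \notin F ->
  (b -> [/\ Y \subset F, n <= #|[set: C]| - 5 & #|[set: C]| - 5 <= n + #|F|]) ->
  exists (v0 e' : C) (F' : {set C}), [/\ v0 \notin [:: e0; v1; e1; z], v0 \notin Y,
    v0 \in F -> ~~ b /\ #|F| = #|[set: C]| - 5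
    & b -> [/\ e' \notin [:: v0; e0; v1], e' \notin Y, #|F'| = n,
               [disjoint F' & [set e'; v0; e0]]
             & F :|: F' :|: [set z in [:: e'; v0; e0; v1; e1]] = setT]].
Proof.
move=> m6 cF cY U e0F v1F e1F; case: b => [/(_ isT)[YF n5 nF]|_]; last first.
  (* If [F] has fewer than [m - 5] elements, [v0] can avoid it too. The values of [e'] and [F'] are
     junk in this case. *)
  have [cF5|cF5] := eqVneq #|F| (#|[set: C]| - 5).
    have [|v0] := @ex_notin C [:: e0, v1, e1, z & enum Y].
      by rewrite /= -cardE; clear -m6 cY; lia.
    by rewrite !inE mem_enum !negb_or => /and5P[? ? ? ? ?]; exists v0, v0, F; split=> //; rewrite !inE !negb_or; apply/and4P.
  have [|v0] := @ex_notin C ([:: e0, v1, e1, z & enum Y] ++ enum F).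
    by rewrite size_cat /= -!cardE; clear -m6 cY cF cF5; lia.
  rewrite mem_cat !inE !mem_enum !negb_or => /andP[/and5P[? ? ? ? ?] vF].
  by exists v0, v0, F; split=> //; [rewrite !inE !negb_or; apply/and4P|rewrite (negPf vF)].
(* The colours still missing at the chosen edge, at least two in number: [v0] and [e'] take two of
   them, and [F'] has to contain the others. *)
pose R := ~: (F :|: [set z in [:: e0; v1; e1]]).
have cR : #|R| + #|F| + 3 = #|[set: C]|.
  rewrite -(card_compl (F :|: [set z in [:: e0; v1; e1]])) -/R -addnA; congr addn.
  rewrite cardsU card_set_uniq // disjoint_setI0 ?cards0 ?subn0 //.
  rewrite disjoint_sym disjoint_subset; apply/subsetP=> w.
  by rewrite !inE => /or3P[]/eqP->.
have [|v0 v0R v0z] := @ex_notin_in C R [:: z]; first by rewrite /=; clear -cR cF m6; lia.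
have [|e' eR ev] := @ex_notin_in C R [:: v0]; first by rewrite /=; clear -cR cF m6; lia.
rewrite !inE in v0z ev.
have RP w : w \in R -> w \notin F /\ [&& w != e0, w != v1 & w != e1].
  by rewrite !inE !negb_or => /andP[].
have [vF /and3P[ve0 vv1 ve1]] := RP _ v0R; have [eF /and3P[ee0 ev1 ee1]] := RP _ eR.
pose A := R :\: [set e'; v0]; pose B := ~: [set z in [:: e'; v0; e0]].
have AB : A \subset B.
  by apply/subsetP=> w; rewrite !inE !negb_or => /andP[/andP[-> ->] /and4P[_ ->]].
have cA : #|A| + 2 = #|R|.
  rewrite cardsD (setIidPr _); last by rewrite subUset !sub1set eR v0R.
  by rewrite cards2 ev; clear -cR cF m6; lia.
have cB : n <= #|B|.
  have := card_compl [set z in [:: e'; v0; e0]]; have := card_set_seq [:: e'; v0; e0].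
  by rewrite -/B /=; clear -n5 m6; lia.
have [|AF FB cF'] := enlargeP (n := n) AB; first by rewrite cB andbT; clear -cA cR nF m6; lia.
exists v0, e', (enlarge A B n); split=> //.
- by rewrite !inE !negb_or ve0 vv1 ve1 v0z.
- by apply: contra vF => /(subsetP YF).
- by rewrite (negPf vF).
move=> _; split=> //.
- by rewrite !inE !negb_or ev ee0 ev1.
- by apply: contra eF => /(subsetP YF).
- rewrite disjoint_subset; apply/subsetP=> w /(subsetP FB).
  by rewrite !inE orbA.
apply/setP=> w; rewrite in_setT 2!in_setU.
case wF: (w \in F) => //; case wA: (w \in A); first by rewrite (subsetP AF).
move: wA; rewrite !inE wF /=; do 5?case: (w =P _) => _ //=; by rewrite ?orbT.
Qed.

(** Usually all five window colours lie outside [F], and [2 * #|F| + 5] is large enough. If the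
    colour of an outer vertex recurs in [F], only four are new, but then [#|F|] is [m - 5], and
    [2 * (m - 5) + 4 >= m] by [m >= 6]. *)
Lemma window_bound (C : finType) (F : {set C}) w1 x1 x2 x3 w2 :
  6 <= #|[set: C]| -> uniq [:: w1; x1; x2; x3; w2] ->
  x1 \notin F -> x2 \notin F -> x3 \notin F -> #|[set: C]| - 5 <= #|F|.*2 ->
  (w1 \in F -> w2 \notin F /\ #|F| = #|[set: C]| - 5) ->
  (w2 \in F -> #|F| = #|[set: C]| - 5) ->
  #|[set: C]| <= #|F :|: [set z in [:: w1; x1; x2; x3; w2]]| + #|F|.
Proof.
move=> m6 U xF1 xF2 xF3 hF H1 H2.
have key s : uniq s -> {subset s <= [:: w1; x1; x2; x3; w2]} -> {in s, forall z, z \notin F} ->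
    #|F| + size s <= #|F :|: [set z in [:: w1; x1; x2; x3; w2]]|.
  move=> us ss sF; rewrite -(card_set_uniq us).
  have <- : #|F :|: [set z in s]| = #|F| + #|[set z in s]|.
    rewrite cardsU disjoint_setI0 ?cards0 ?subn0 // disjoint_sym disjoint_subset.
    by apply/subsetP=> z; rewrite inE => /sF.
  by apply: subset_leq_card; apply: setUS; apply/subsetP=> z; rewrite !in_set => /ss.
case: (boolP (w1 \in F)) => wF1.
  have [wF2 cF] := H1 wF1; have := key [:: x1; x2; x3; w2].
  have -> : uniq [:: x1; x2; x3; w2] by move: U; rewrite cons_uniq => /andP[].
  move=> /(_ isT) H.
  suff : #|F| + 4 <= #|F :|: [set z in [:: w1; x1; x2; x3; w2]]| by clear -cF m6; lia.
  apply: H => z; first by move=> zs; rewrite in_cons zs orbT.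
  by rewrite !inE => /or4P[]/eqP->.
case: (boolP (w2 \in F)) => wF2.
  have cF := H2 wF2; have := key [:: w1; x1; x2; x3].
  have -> : uniq [:: w1; x1; x2; x3].
    by move: U; rewrite -(cat1s w2) -[[:: w1, _, _, _ & _]]/([:: w1; x1; x2; x3] ++ _) cat_uniq => /andP[].
  move=> /(_ isT) H.
  suff : #|F| + 4 <= #|F :|: [set z in [:: w1; x1; x2; x3; w2]]| by clear -cF m6; lia.
  apply: H => z; first by rewrite !inE => /or4P[]->; rewrite ?orbT.
  by rewrite !inE => /or4P[]/eqP->.
suff : #|F| + 5 <= #|F :|: [set z in [:: w1; x1; x2; x3; w2]]| by clear -hF m6; lia.
by apply: (key [:: w1; x1; x2; x3; w2]) => // z; rewrite !inE => /or4P[|||/orP[]]/eqP->.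
Qed.

(** The list is coloured from its last element to its head. By the [pairwise] hypothesis the head
    occurs in no constraint of the positions coloured before it, so choosing its colour preserves
    them. *)
Lemma greedy_colouring (C : finType) (s : seq nat) (nb : nat -> seq nat) (c : nat -> C) :
  uniq s -> pairwise (fun j i => j \notin nb i) s ->
  {in s, forall j, j \notin nb j /\ size (nb j) < #|[set: C]|} ->
  exists2 c' : nat -> C, forall j, j \notin s -> c' j = c j
    & forall j k, j \in s -> k \in nb j -> c' j != c' k.
Proof.
elim: s => [|j s IH] /=; first by exists c.
move=> /andP[js us] /andP[/allP jnb pw] H.
have [|c' c'c c'nb] := IH us pw.
  by move=> i si; apply: H; rewrite inE si orbT.
have [jj /= nbj] := H j (mem_head _ _).
have [|z] := @ex_notin C (map c' (nb j)); first by rewrite size_map.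
move=> zj; exists (fun i => if i == j then z else c' i) => [i|i k].
  by rewrite inE negb_or => /andP[/negPf-> /c'c].
rewrite inE; have [-> _ kj|ij /= si ki] := eqVneq i j.
  have [kk|_] := eqVneq k j; first by rewrite kk (negPf jj) in kj.
  by apply: contraNneq zj => ->; apply: map_f.
have [kk|_] := eqVneq k j; last exact: c'nb.
by have := jnb _ si; rewrite -kk ki.
Qed.

(* A free position on the left of the block is in conflict with the four positions
   on its right and with the nearest position on its left if that one is in [K];
   this makes all five-element windows centred at [K] rainbow. *)
Lemma extend_outward (C : finType) (c : nat -> C) (K : pred nat) A B N :
  6 <= #|[set: C]| -> A + 3 <= B -> (forall j, K j -> ~~ odd j) ->
  exists c' : nat -> C,
  [/\ forall j, (A <= j <= B) || K j -> c' j = c j,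
      forall j, j < A -> ~~ K j -> (forall k, j < k <= j + 4 -> c' j != c' k) /\
                (forall k, K k -> k < j <= k + 2 -> c' j != c' k)
    & forall j, B < j <= N -> ~~ K j -> (forall k, k < j <= k + 4 -> c' j != c' k) /\
                (forall k, K k -> j < k <= j + 2 -> c' j != c' k)].
Proof.
move=> m6 AB Kev.
(* [K] contains even positions only, so the nearest candidate to the left is [j - 1] or [j - 2],
   whichever is even. *)
pose nb1 j := iota j.+1 4 ++ [seq k <- [:: j.-1./2.*2] | K k].
pose s1 := [seq j <- iota 0 A | ~~ K j].
have ps1 : pairwise ltn s1.
  by rewrite -sorted_pairwise ?sorted_filter ?iota_ltn_sorted //; exact: ltn_trans.
have [|||c1 c1c c1nb] := @greedy_colouring C s1 nb1 c.
- by rewrite filter_uniq ?iota_uniq.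
- apply: (@sub_in_pairwise _ (mem s1) ltn) (allss s1) ps1 => j i; rewrite !mem_filter /= mem_cat mem_iota mem_filter.
  by case: (K j) => //= _ _; clear; lia.
- move=> j; rewrite mem_filter => /andP[Kj _]; split; last first.
    by rewrite size_cat size_iota /=; case: ifP => /= _; clear -m6; lia.
  by rewrite mem_cat mem_iota mem_filter (negPf Kj) /=; clear; lia.
(* The mirror image; the list is reversed, since the greedy colouring starts at its end and has to
   proceed from left to right here. *)
pose nb2 j := iota (j - 4) 4 ++ [seq k <- [:: j./2.+1.*2] | K k].
pose s2 := rev [seq j <- iota B.+1 (N - B) | ~~ K j].
have s2P j : (j \in s2) = ~~ K j && (B < j <= N).
  by rewrite mem_rev mem_filter mem_iota; congr andb; clear; lia.
have ps2 : pairwise (fun j i => i < j) s2.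
  rewrite -sorted_pairwise; last by move=> j k i; rewrite [X in X -> _ -> _]/=; clear; lia.
  by rewrite rev_sorted sorted_filter ?iota_ltn_sorted //; exact: ltn_trans.
have [|||c2 c2c c2nb] := @greedy_colouring C s2 nb2 c1.
- by rewrite rev_uniq filter_uniq ?iota_uniq.
- apply: (@sub_in_pairwise _ (mem s2) (fun j i => i < j)) (allss s2) ps2 => j i; rewrite !s2P /= mem_cat mem_iota mem_filter.
  by move=> /andP[/negPf-> _] /andP[_ hi] /=; clear -AB hi; lia.
- move=> j; rewrite s2P => /andP[Kj jB]; split; last first.
    by rewrite size_cat size_iota /=; case: ifP => /= _; clear -m6; lia.
  by rewrite mem_cat mem_iota mem_filter (negPf Kj) /=; clear -jB AB; lia.
have c21 j : K j || (j <= B) -> c2 j = c1 j.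
  move=> h; apply: c2c; rewrite s2P; case: (K j) h => //= h; clear -h; lia.
exists c2; split.
- move=> j h; rewrite c21; last by case: (K j) h; rewrite ?orbT //= ?orbF; clear; lia.
  apply: c1c; rewrite mem_filter mem_iota; case: (K j) h => //=; rewrite ?orbF; clear; lia.
- move=> j jA Kj.
  have sj : j \in s1 by rewrite mem_filter Kj mem_iota.
  rewrite c21; last by clear -jA AB; lia.
  split=> [k hk|k Kk hk]; rewrite c21 ?Kk //; try (by clear -jA AB hk; lia);
    apply: c1nb => //; rewrite mem_cat mem_filter mem_iota.
    by apply/orP; left; clear -hk; lia.
  by rewrite Kk inE orbC /=; have := Kev _ Kk; clear -hk; lia.
move=> j jB Kj.
have sj : j \in s2 by rewrite s2P Kj jB.
split=> [k hk|k Kk hk]; apply: c2nb => //; rewrite mem_cat mem_filter mem_iota.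
  by apply/orP; left; clear -hk jB AB; lia.
by rewrite Kk inE orbC /=; have := Kev _ Kk; clear -hk; lia.
Qed.

(* [L i] is the number of leaves hanging at vertex [i]; only the vertices [1..r]
   and the edges between them can be total b-chromatic.  A vertex [i] needs its
   [L i] leaves to supply the colours that it does not see otherwise. *)
Definition line_solution (C : finType) (L : nat -> nat) r (c : nat -> C)
    (F : nat -> {set C}) : Prop :=
  [/\ forall j k, j < k <= j + 2 -> k <= r.*2.+2 -> c j != c k,
    forall i, 0 < i -> [/\ #|F i| = L i, c i.*2.-1 \notin F i, c i.*2 \notin F i
                         & c i.*2.+1 \notin F i]
  & forall z, (exists i, [/\ 0 < i <= r, c i.*2 = z
                  & #|[set: C]| <= #|F i :|: seq_set c i.*2.-2 5| + L i]) \/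
                (exists i, [/\ 0 < i < r, c i.*2.+1 = z
                  & F i :|: F i.+1 :|: seq_set c i.*2.-1 5 = setT])].

(** * Colouring the whole line *)

(* The chosen block consists of the vertices [a+1..a+p] and the edges between
   them, together with the edge [a, a+1] if [lam] and the edge [a+p, a+p+1] if
   [rho]; [I] lists the other chosen vertices. *)
Section LineColouring.
Variables (C : finType) (L : nat -> nat) (a p r : nat) (lam rho : bool) (I : seq nat).
Local Notation m := #|[set: C]|.
Hypotheses (m6 : 6 <= m) (p0 : 0 < p) (p1 : p = 1 -> lam || rho).
Hypotheses (uI : uniq I) (hm : p.*2.-1 + lam + rho + size I = m).
Hypothesis hL : forall i, L i <= m - 5.
Hypothesis hI : forall i, i \in I ->
  [/\ 0 < i <= r, m - 5 <= (L i).*2, (i < a) || (a + p + 1 < i) & i.+1 \notin I].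
Hypothesis hP : forall i, a < i <= a + p -> m - 5 <= (L i).*2.
Hypotheses (pr : a + p + rho <= r) (a0 : lam -> 0 < a).
Hypotheses (eL : lam -> m - 5 <= L a + L a.+1)
  (eR : rho -> m - 5 <= L (a + p) + L (a + p).+1).
Hypotheses (nL : lam -> a.-1 \in I -> L a.-1 < L a.+1)
  (nR : rho -> (a + p).+2 \in I -> L (a + p).+2 < L (a + p)).
Hypothesis exc : lam -> rho -> (L (a + p).+1).*2 < m - 5.

Let K := iota (a.*2.+2 - lam) (p.*2.-1 + lam + rho) ++ map double I.
Let isI j := ~~ odd j && (j./2 \in I).

Lemma isI_map j : (j \in map double I) = isI j.
Proof.
apply/mapP/andP => [[i iI ->]|[jo jI]]; first by rewrite odd_double doubleK.
by exists j./2; rewrite ?even_halfK.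
Qed.

Lemma mem_chosen j : (j \in K) = (a.*2.+2 - lam <= j < (a + p).*2.+1 + rho) || isI j.
Proof. by rewrite mem_cat mem_iota isI_map; congr orb; clear -p0; case: lam; lia. Qed.

Lemma isI_far j : isI j -> (j < a.*2.-1) || ((a + p).*2.+3 < j).
Proof. by case/andP=> jo /hI[_ _ h _]; clear -jo h; lia. Qed.

Lemma uniq_chosen : uniq K.
Proof.
rewrite cat_uniq iota_uniq map_inj_uniq ?uI ?andbT; last by move=> i j /double_inj.
apply/hasPn=> j; rewrite isI_map => /isI_far h; rewrite /= mem_iota.
by clear -h p0; case: lam; case: rho; lia.
Qed.

Lemma card_chosen : size K = m.
Proof. by rewrite size_cat size_iota size_map -hm. Qed.

Lemma base_colouring : exists2 c : nat -> C, {in K &, injective c} &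
  forall z, exists2 j, j \in K & c j = z.
Proof.
have [|z0 _] := @ex_notin C [::]; first by rewrite /=; clear -m6; lia.
have eC : size (enum [set: C]) = m by rewrite -cardE.
exists (fun j => nth z0 (enum [set: C]) (index j K)) => [j k jK kK /eqP|z].
  rewrite nth_uniq ?enum_uniq ?eC -?card_chosen ?index_mem // => /eqP.
  by apply: index_inj.
have zi : index z (enum [set: C]) < size K.
  by rewrite card_chosen -eC index_mem mem_enum inE.
exists (nth 0 K (index z (enum [set: C]))); first exact: mem_nth.
by rewrite index_uniq ?uniq_chosen // nth_index // mem_enum inE.
Qed.

(** Index 0 of [y] is the edge at position [a.*2.+1]; the isolated chosen vertices to be taken care
    of are [a.-1] and [(a + p).+2]. *)
Lemma path_colouring (c0 : nat -> C) : {in K &, injective c0} ->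
  exists y F, (forall j, ~~ lam <= j < p.*2 + rho -> y j = c0 (a.*2.+1 + j)) /\
    path_solution (fun i => L (a + i).+1)
      (if lam && (a.-1 \in I) then [set c0 a.-1.*2] else set0)
      (if rho && ((a + p).+2 \in I) then [set c0 (a + p).*2.+4] else set0) p y F.
Proof.
move=> cinj; set YL := (X in path_solution _ X); set YR := (X in path_solution _ _ X).
have isI2 i : i \in I -> isI i.*2 by rewrite /isI odd_double doubleK.
have inK j : ~~ lam <= j < p.*2 + rho -> a.*2.+1 + j \in K.
  by move=> hj; rewrite mem_chosen; apply/orP; left; clear -hj; lia.
have inj : {in [pred j | ~~ lam <= j < p.*2 + rho] &, injective (fun j => c0 (a.*2.+1 + j))}.
  by move=> j k hj hk /cinj H; apply/eqP; rewrite -(eqn_add2l a.*2.+1) H ?inK.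
have [h h_lb h_ub] : exists2 h, m - 5 <= h.*2 & h.*2 <= m - 4.
  by exists (uphalf (m - 5)); clear -m6; lia.
have hh i : m - 5 <= (L i).*2 -> h <= L i by clear -m6 h_ub; lia.
have YL1 : #|YL| <= 1 by rewrite /YL; case: ifP => _; rewrite ?cards1 ?cards0.
have YR1 : #|YR| <= 1 by rewrite /YR; case: ifP => _; rewrite ?cards1 ?cards0.
have LaP k : k < p -> h <= L (a + k).+1.
  by move=> kp; apply: hh; apply: hP; clear -kp; lia.
(* A chosen vertex [a.-1] satisfies [h <= L a.-1], and [nL] provides the additional place for its
   colour. *)
have YLL : #|YL| + h <= L (a + 0).+1.
  have := LaP 0 p0; rewrite addn0 /YL; case: ifP => [/andP[l aI]|_ h0]; last by rewrite cards0.
  have := nL l aI; have [_ /hh h1 _ _] := hI aI; rewrite cards1; clear -h1; lia.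
have ap : (a + p.-1).+1 = a + p by clear -p0; lia.
have YRL : #|YR| + h <= L (a + p.-1).+1.
  have pp : p.-1 < p by clear -p0; lia.
  have := LaP _ pp; rewrite ap /YR; case: ifP => [/andP[l aI]|_ h0]; last by rewrite cards0.
  have := nR l aI; have [_ /hh h1 _ _] := hI aI; rewrite cards1; clear -h1; lia.
have dL j : lam -> j < p.*2 + rho -> c0 (a.*2.+1 + j) \notin YL.
  move=> l hj; rewrite /YL l /=; case: ifP => [aI|]; rewrite inE //.
  apply/eqP=> /cinj H; have : a.*2.+1 + j = a.-1.*2; last by clear; lia.
  by apply: H; [apply: inK; rewrite l|rewrite mem_chosen isI2 ?orbT].
have dR j : rho -> ~~ lam <= j <= p.*2 -> c0 (a.*2.+1 + j) \notin YR.
  move=> l hj; rewrite /YR l /=; case: ifP => [aI|]; rewrite inE //.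
  apply/eqP=> /cinj H; have : a.*2.+1 + j = (a + p).*2.+4; last by clear -hj; lia.
  by apply: H; [apply: inK; rewrite l; clear -hj; lia|rewrite mem_chosen (isI2 (a + p).+2) ?orbT].
have YL0 : ~~ lam -> YL == set0 by rewrite /YL => /negPf->.
have YR0 : ~~ rho -> YR == set0 by rewrite /YR => /negPf->.
have hLp k : k < p -> h <= L (a + k).+1 <= m - 5 by move=> kp; rewrite LaP // hL.
(* Here [I] is empty, hence so is [YR]. By [exc] and [eR], [L (a + p)] exceeds half of [m - 5]; this
   half is [h], because [m] is odd. *)
have hexc : lam -> rho -> m = p.*2.+1 -> #|YR| + h < L (a + p.-1).+1.
  move=> l r' mp; rewrite ap; have := exc l r'; have := eR r'.
  have -> : YR = set0.
    rewrite /YR; case: ifP => // /andP[_ aI]; have I0 : size I = 0.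
      by move: hm; rewrite l r' mp; clear -p0; lia.
    by rewrite (size0nil I0) in aI.
  by rewrite cards0; clear -h_ub mp m6; lia.
case: p p0 inj hLp YRL dL dR hexc => [|[|q]] // _ inj hLp YRL dL dR hexc.
  apply: (@path_solution_vertex _ lam rho _ _ _ h) => //.
  - by have /andP[] := hLp 0 isT.
  - by case: ifP => [l j|/negbT]; [exact: dL|exact: YL0].
  - by case: ifP => [l j|/negbT]; [exact: dR|exact: YR0].
apply: (@path_solution_many _ lam rho _ _ _ h) => //.
- move=> j j3; case: ifP => [l|/negbT]; last exact: YL0.
  by apply: dL => //; clear -j3; lia.
move=> j j3; case: ifP => [l|/negbT]; last exact: YR0.
by apply: dR => //; clear -j3; lia.
Qed.

(** Built from the inside out: the block, its two ends, the rest of the line. Isolated chosen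
    vertices have [F] disjoint from their five-coloured window, block vertices use [window_bound],
    and the sets at the two ends of a chosen edge cover what its window lacks. *)
Lemma line_colouring : exists (c : nat -> C) (F : nat -> {set C}), line_solution L r c F.
Proof.
have [c0 cinj csurj] := base_colouring.
have [y [F0 [yc [ys1 ys2 ys3 [yYL yYR] [yp1 yp2 yp3 yp4]]]]] := path_colouring cinj.
have inK j : ~~ lam <= j < p.*2 + rho -> a.*2.+1 + j \in K.
  by move=> hj; rewrite mem_chosen; apply/orP; left; clear -hj; lia.
have yne j k : ~~ lam <= j -> j < k -> k < p.*2 + rho -> y j != y k.
  move=> j0 jk kp.
  have hj : ~~ lam <= j < p.*2 + rho by clear -j0 jk kp; lia.
  have hk : ~~ lam <= k < p.*2 + rho by clear -j0 jk kp; lia.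
  rewrite !yc //; apply/eqP=> /cinj; rewrite !inK // => /(_ isT isT).
  by clear -jk; lia.
have yprop j k : j < k <= j + 2 -> k <= p.*2 -> y j != y k.
  move=> jk kp; have [h|h] := boolP ((~~ lam <= j) && (k < p.*2 + rho)).
    by case/andP: h => j0; apply: yne => //; case/andP: jk.
  have [j0|j0] := posnP j.
    move: yp1; rewrite j0 !inE negb_or => /andP[y01 y02].
    have [->|->] // : k = 1 \/ k = 2 by clear -jk j0; lia.
  have kp2 : k = p.*2 by clear -h kp j0; lia.
  move: yp2; rewrite kp2 !inE negb_or ![y p.*2 == _]eq_sym => /andP[y01 y02].
  have [->|->] // : j = p.*2.-1 \/ j = p.*2.-2 by clear -jk kp2; lia.
have hF0 k : k < p -> #|F0 k| = L (a + k).+1 by move=> /ys1[].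
pose YX := if a.-1 \in I then [set c0 a.-1.*2] else set0.
pose YZ := if (a + p).+2 \in I then [set c0 (a + p).*2.+4] else set0.
have YX1 : #|YX| <= 1 by rewrite /YX; case: ifP => _; rewrite ?cards1 ?cards0.
have YZ1 : #|YZ| <= 1 by rewrite /YZ; case: ifP => _; rewrite ?cards1 ?cards0.
have p2 : 2 <= p.*2 by clear -p0; lia.
have pp : p.-1 < p by clear -p0; lia.
have [|||||||v0 [e1 [F1 [v0n v0Y v0F vlam]]]] :=
  @end_extension C lam (F0 0) (y 0) (y 1) (y 2) (y 3) YX (L a) m6.
- by rewrite hF0.
- by [].
- rewrite /= !inE negb_or !yprop //; clear -p2; lia.
- by case: (ys1 0 p0).
- by case: (ys1 0 p0).
- by case: (ys1 0 p0).
- by move=> l; move: yYL; rewrite l hF0 // addn0; split=> //; exact: eL.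
(* The vertex on the other side of the last block vertex; for [p = 1] this is the new vertex on the
   left, so [v0] and [w0] are made different. *)
pose z := if p == 1 then v0 else y p.*2.-1.-2.
have pE : [/\ p.-1.*2.+2 = p.*2, p.-1.*2.+1 = p.*2.-1 & p.-1.*2 = p.*2.-2].
  by split; clear -p0; lia.
have ysp := ys1 _ pp; case: pE ysp => -> -> -> ysp.
have ap : (a + p.-1).+1 = a + p by clear -p0; lia.
have [|||||||w0 [e2 [F2 [w0n w0Y w0F wrho]]]] :=
  @end_extension C rho (F0 p.-1) (y p.*2) (y p.*2.-1) (y p.*2.-2) z YZ (L (a + p).+1) m6.
- by rewrite hF0.
- by [].
- rewrite /= !inE negb_or ![_ == y p.*2.-2]eq_sym [_ == y p.*2.-1]eq_sym !yprop //;
    by clear -p2; lia.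
- by case: ysp.
- by case: ysp.
- by case: ysp.
- move=> l; move: yYR; rewrite l hF0 // ap; split=> //.
  by rewrite addnC; exact: eR.
(* Index [t] stands for position 2a + t - 1: the block [y] shifted by two, with two new elements on
   either side. The values [e1] and [e2] are meaningful only under [lam] and [rho]. *)
pose blk t := if t == 0 then e1 else if t == 1 then v0 else
  if t <= p.*2.+2 then y t.-2 else if t == p.*2.+3 then w0 else e2.
have blk2 t : t <= p.*2 -> blk t.+2 = y t by move=> tp; rewrite /blk /= !ltnS tp.
have blk3 : blk p.*2.+3 = w0 by rewrite /blk /= ltnn eqxx.
have blk4 : blk p.*2.+4 = e2.
  by rewrite /blk /= ltnNge leqW //= -[p.*2.+4]addn1 -{2}[p.*2.+3]addn0 eqn_add2l.
have bprop t u : t < u <= t + 2 -> ~~ lam <= t -> u <= p.*2.+3 + rho -> blk t != blk u.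
  move=> tu lt up.
  case: t tu lt => [|[|t]] tu lt.
  - have l : lam by clear -lt; case: lam lt.
    have [] := vlam l; rewrite !inE !negb_or => /and3P[ev0 ey0 _] _ _ _ _.
    by have [->|->] : u = 1 \/ u = 2; [clear -tu; lia|rewrite /blk|rewrite (blk2 0)].
  - move: v0n; rewrite !inE !negb_or => /and4P[v1 v2 _ _].
    have [->|->] : u = 2 \/ u = 3 by clear -tu; lia.
      by rewrite (blk2 0).
    by rewrite (blk2 1) //; clear -p2; lia.
  case: u tu up => [|[|u]] tu up; [by clear -tu; lia|by clear -tu; lia|].
  have [up2|up2] := leqP u p.*2.
    rewrite !blk2 //; last by clear -tu up2; lia.
    by apply: yprop => //; clear -tu; lia.
  have [uE|[r1 uE]] : u = p.*2.+1 \/ rho /\ u = p.*2.+2.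
    clear -up up2; case: rho up => up; last by left; lia.
    by have [->|->] : u = p.*2.+1 \/ u = p.*2.+2; [lia|left|right].
    move: w0n; rewrite uE blk3 eq_sym !inE !negb_or => /and4P[w1 w2 _ _].
    by have [->|->] : t = p.*2 \/ t = p.*2.-1; [clear -tu uE; lia|rewrite blk2|rewrite blk2 //; clear; lia].
  have [] := wrho r1; rewrite !inE !negb_or => /and3P[ev0 ey0 _] _ _ _ _.
  rewrite uE blk4 eq_sym.
  by have [->|->] : t = p.*2.+1 \/ t = p.*2; [clear -tu uE; lia|rewrite blk3|rewrite blk2].
(* The first and the last position fixed so far; the outermost edges count only next to a chosen end
   edge. The greedy extension ends at 2r + 5, beyond all windows. *)
pose A := a.*2 - lam; pose B := (a + p).*2.+2 + rho.
pose cb j := if isI j then c0 j else blk (j.+1 - a.*2).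
have [||c [cK cl cr]] := @extend_outward C cb isI A B (r.*2 + 5) m6.
- by rewrite /A /B; clear -p0; lia.
- by move=> j /andP[].
have cI j : isI j -> c j = c0 j by move=> jI; rewrite cK /cb ?jI ?orbT.
have cE t : ~~ lam <= t -> t <= p.*2.+3 + rho -> c (a.*2 + t).-1 = blk t.
  move=> t0 tp.
  have at0 : (a.*2 + t).-1.+1 = a.*2 + t.
    by clear -a0 t0; case: lam a0 t0 => [/(_ isT)|_]; lia.
  rewrite cK; last by apply/orP; left; rewrite /A /B; clear -at0 t0 tp; lia.
  rewrite /cb at0 addKn; case: ifP => // /isI_far.
  by clear -at0 t0 tp; case: lam t0; case: rho tp; lia.
have ce1 : lam -> c a.*2.-1 = e1 by move=> l; have := cE 0; rewrite addn0 l; apply.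
have cv0 : c a.*2 = v0 by have := cE 1; rewrite addn1; apply => //; case: lam.
have cy t : t <= p.*2 -> c (a.*2.+1 + t) = y t.
  move=> tp; have := cE t.+2; rewrite blk2 // !addnS /= addSn; apply; first by case: lam.
  by clear -tp; lia.
have cw0 : c (a + p).*2.+2 = w0.
  have := cE p.*2.+3; rewrite blk3 !addnS /= doubleD; apply; first by case: lam.
  by clear; lia.
have ce2 : rho -> c (a + p).*2.+3 = e2.
  move=> r1; have := cE p.*2.+4; rewrite r1 blk4 !addnS addn0 /= doubleD; apply=> //.
  by case: lam.
have isIS j : isI j -> ~~ isI j.+2.
  by case/andP=> jo jI; apply/negP=> /andP[_ jI2]; have [_ _ _ /negP[]] := hI jI.
have isI1 j : isI j -> ~~ isI j.+1 by case/andP=> jo _; rewrite /isI /= jo.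
have cprop j k : j < k <= j + 2 -> k <= r.*2 + 5 -> c j != c k.
  move=> jk kN; have [jA|jA] := ltnP j A.
    have [jI|jI] := boolP (isI j); last first.
      by have [H _] := cl j jA jI; apply: H; clear -jk; lia.
    have [kA|kA] := ltnP k A.
      have kI : ~~ isI k.
        by have [->|->] : k = j.+1 \/ k = j.+2; [clear -jk; lia|exact: isI1|exact: isIS].
      by have [_ H] := cl k kA kI; rewrite eq_sym; apply: H.
    have [j2 a1] : j = a.-1.*2 /\ 0 < a.
      by have := isI_far jI; case/andP: jI => jo _; clear -jk kA jA jo; rewrite /A in kA jA; split; lia.
    have aI : a.-1 \in I by case/andP: jI => _; rewrite j2 doubleK.
    rewrite cI // j2 eq_sym.
    have [->|[l ->]] : k = a.*2 \/ lam /\ k = a.*2.-1.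
      rewrite /A in kA; clear -a1 jk j2 kA; case: lam kA => kA; last by left; lia.
      by have [->|->] : k = a.*2 \/ k = a.*2.-1; [lia|left|right].
      by move: v0Y; rewrite cv0 /YX aI inE.
    by have [_] := vlam l; rewrite ce1 // /YX aI inE.
  have [kB|kB] := leqP k B.
    have jt : j = (a.*2 + (j.+1 - a.*2)).-1 by rewrite /A in jA; clear -jA; lia.
    have kt : k = (a.*2 + (k.+1 - a.*2)).-1 by rewrite /A in jA; clear -jA jk; lia.
    rewrite /A in jA; rewrite /B in kB.
    have aa : lam <= a.*2 by case: lam a0 => // /(_ isT); clear; lia.
    have [h1 h2] : ~~ lam <= j.+1 - a.*2 /\ k.+1 - a.*2 <= p.*2.+3 + rho.
      by split; clear -jA kB jk aa; lia.
    have h3 : j.+1 - a.*2 < k.+1 - a.*2 <= j.+1 - a.*2 + 2 by clear -jA jk aa; lia.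
    rewrite jt kt !cE ?bprop //; clear -h1 h2 h3; lia.
  have [kI|kI] := boolP (isI k); last first.
    have kBN : B < k <= r.*2 + 5 by rewrite kB.
    by have [H _] := cr k kBN kI; rewrite eq_sym; apply: H; clear -jk; lia.
  have [jB|jB] := leqP j B.
    have k2 : k = (a + p).+2.*2.
      by have := isI_far kI; case/andP: kI => ko _; rewrite /A in jA; rewrite /B in kB jB; clear -jk jA jB kB ko; lia.
    have aI : (a + p).+2 \in I by case/andP: kI => _; rewrite k2 doubleK.
    rewrite (cI k) // k2.
    have [->|[l ->]] : j = (a + p).*2.+2 \/ rho /\ j = (a + p).*2.+3.
      rewrite /B in jB; clear -jk k2 jB; case: rho jB => jB; [|left; lia].
      by have [->|->] : j = (a + p).*2.+2 \/ j = (a + p).*2.+3; [lia|left|right].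
      by move: w0Y; rewrite cw0 /YZ aI inE.
    by have [_] := wrho l; rewrite ce2 // /YZ aI inE.
  have jI : ~~ isI j.
    by apply: contraL kI => jI; have [->|->] : k = j.+1 \/ k = j.+2; [clear -jk; lia|exact: isI1|exact: isIS].
  have jBN : B < j <= r.*2 + 5 by rewrite jB; clear -jk kN; lia.
  by have [_ H] := cr j jBN jI; apply: H.
(* Isolated chosen vertices avoid their entire window, so that no colour is wasted; the remaining
   vertices outside the block only avoid the three line elements at them. *)
pose Fi i := if a < i <= a + p then F0 (i - a).-1 else
  if lam && (i == a) then F1 else if rho && (i == (a + p).+1) then F2 else
  if i \in I then enlarge set0 (~: seq_set c i.*2.-2 5) (L i)
  else enlarge set0 (~: seq_set c i.*2.-1 3) (L i).
have FiP k : k < p -> Fi (a + k).+1 = F0 k.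
  move=> kp; rewrite /Fi ifT; last by clear -kp; lia.
  by congr F0; clear; lia.
have FiL : lam -> Fi a = F1 by move=> l; rewrite /Fi ltnn l eqxx.
have FiR : rho -> Fi (a + p).+1 = F2.
  move=> l; rewrite /Fi ltnn andbF l eqxx ifF //.
  by apply/negbTE; rewrite negb_and; apply/orP; right; clear; lia.
have fillC (A' : {set C}) i : #|A'| <= 5 ->
    enlarge set0 (~: A') (L i) \subset ~: A' /\ #|enlarge set0 (~: A') (L i)| = L i.
  move=> A5; have [||_ sF cF] := enlargeP (A := set0) (B := ~: A') (n := L i); last by split.
    exact: sub0set.
  by rewrite cards0 /=; have := card_compl A'; have := hL i; clear -A5 m6; lia.
have css n j : n <= 5 -> #|seq_set c j n| <= 5.
  by move=> n5; apply: leq_trans (card_set_seq _) _; rewrite size_map size_iota.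
exists c, Fi; split.
- by move=> j k jk kr; apply: cprop => //; clear -kr; lia.
- move=> i i0; have [ip|ip] := boolP (a < i <= a + p).
    have [k kp ->] : exists2 k, k < p & i = (a + k).+1.
      by exists (i - a).-1; clear -ip; lia.
    rewrite FiP //; have [-> k1 k2 k3] := ys1 k kp; split=> //.
    - rewrite (_ : _.-1 = a.*2.+1 + k.*2) ?cy //; clear -kp; lia.
    - rewrite (_ : _.*2 = a.*2.+1 + k.*2.+1) ?cy //; clear -kp; lia.
    - rewrite (_ : _.+1 = a.*2.+1 + k.*2.+2) ?cy //; clear -kp; lia.
  have [/andP[l /eqP->]|il] := boolP (lam && (i == a)).
    rewrite FiL //; have [_ _ cF1 dis _] := vlam l; split=> //.
    - by apply: contraL dis => h; apply/pred0Pn; exists e1; rewrite /= !inE eqxx -ce1 ?h.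
    - by apply: contraL dis => h; apply/pred0Pn; exists v0; rewrite /= !inE eqxx -cv0 ?h ?orbT.
    - by apply: contraL dis => h; apply/pred0Pn; exists (y 0); rewrite /= !inE eqxx -(cy 0) // addn0 h ?orbT.
  have [/andP[l /eqP->]|ir] := boolP (rho && (i == (a + p).+1)).
    have cyp : c (a + p).*2.+1 = y p.*2.
      by rewrite -cy //; congr c; clear; lia.
    rewrite FiR //; have [_ _ cF1 dis _] := wrho l; split=> //.
    - by apply: contraL dis => h; apply/pred0Pn; exists (y p.*2); rewrite /= !inE eqxx -cyp h ?orbT.
    - by apply: contraL dis => h; apply/pred0Pn; exists w0; rewrite /= !inE eqxx -cw0 h ?orbT.
    - by apply: contraL dis => h; apply/pred0Pn; exists e2; rewrite /= !inE eqxx -ce2 // h ?orbT.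
  rewrite /Fi (negPf ip) (negPf il) (negPf ir).
  have H n j : n <= 5 -> j <= i.*2.-1 -> i.*2.+1 < j + n -> [/\ #|enlarge set0 (~: seq_set c j n) (L i)| = L i,
    c i.*2.-1 \notin enlarge set0 (~: seq_set c j n) (L i),
    c i.*2 \notin enlarge set0 (~: seq_set c j n) (L i) &
    c i.*2.+1 \notin enlarge set0 (~: seq_set c j n) (L i)].
    move=> n5 j1 j2; have [/subsetP sF cF] := fillC _ i (css n j n5).
    have N k : j <= k < j + n -> c k \notin enlarge set0 (~: seq_set c j n) (L i).
      move=> kj; apply/negP=> /sF; rewrite in_setC => /negP[].
      by apply/seq_setP; exists k.
    by split=> //; apply: N; clear -j1 j2 i0; lia.
  by case: ifP => _; apply: H => //; clear -i0; lia.
move=> z1; have [j] := csurj z1; rewrite mem_chosen.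
have [jI _ cj|jI /orP[hj cj|//]] := boolP (isI j).
  left; exists j./2; have [jo jj] := andP jI.
  have [/andP[i0 ir] iL ifar iS] := hI jj; rewrite i0 ir (even_halfK jo) cI //; split=> //.
  have far : j < a.*2 - lam \/ B < j.
    by have := isI_far jI; rewrite /B; clear -jo a0; case: lam a0 => [/(_ isT)|_]; case: rho; lia.
  (* Two positions of this window that are three or four apart are both free, and [extend_outward]
     separates them. *)
  have cne k l : j.-2 <= k -> k < l -> l <= j.+2 -> c k != c l.
    move=> jk kl lj; have [lk|lk] := leqP l (k + 2).
      by apply: cprop; [rewrite kl lk|rewrite -(even_halfK jo) in lj; clear -lj ir; lia].
    have j2 : 2 <= j by rewrite -(even_halfK jo); clear -i0; lia.
    have kI : ~~ isI k.
      have [->|kE] : k = j.-1 \/ j = k.+2 by clear -jk kl lj lk j2; lia.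
        by rewrite /isI (_ : odd j.-1) //; clear -jo j2; lia.
      by apply/negP=> /isIS; rewrite -kE jI.
    have lI : ~~ isI l.
      by have [->|->] : l = j.+1 \/ l = j.+2; [clear -jk kl lj lk j2; lia|exact: isI1|exact: isIS].
    case: far => far.
      have kA : k < A by rewrite /A; clear -far jk kl lj lk; lia.
      by have [H _] := cl k kA kI; apply: H; clear -jk kl lj; lia.
    have lB : B < l <= r.*2 + 5.
      by rewrite -(even_halfK jo) in lj far jk lk; clear -far jk lj lk ir; lia.
    by have [H _] := cr l lB lI; rewrite eq_sym; apply: H; clear -jk kl lj j2; lia.
  have cW : #|seq_set c j.-2 5| = 5.
    rewrite card_set_uniq ?size_map // map_inj_in_uniq ?iota_uniq // => k l.
    rewrite !mem_iota => hk hl ckl; case: (ltngtP k l) => // kl.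
      have := cne k l; rewrite ckl eqxx kl; clear -hk hl i0 jo => H.
      by have := even_halfK jo; have := H _ isT; lia.
    have := cne l k; rewrite ckl eqxx kl; clear -hk hl i0 jo => H.
    by have := even_halfK jo; have := H _ isT; lia.
  have nP : ~~ (a < j./2 <= a + p) by clear -ifar; lia.
  have nl : ~~ (lam && (j./2 == a)) by clear -ifar; case: lam => //=; lia.
  have nr : ~~ (rho && (j./2 == (a + p).+1)) by clear -ifar; case: rho => //=; lia.
  rewrite /Fi (negPf nP) (negPf nl) (negPf nr) jj (even_halfK jo).
  have [sF cF] := fillC _ j./2 (css 5 j.-2 isT).
  rewrite cardsU cF cW disjoint_setI0 ?cards0; last by rewrite disjoints_subset.
  by clear -iL m6; lia.
have [t tp jE] : exists2 t, ~~ lam <= t < p.*2 + rho & j = a.*2.+1 + t.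
  by exists (j - a.*2.+1); clear -hj a0; case: lam a0 hj => [/(_ isT)|_] hj; lia.
have {cj} <- : y t = z1 by rewrite yc // -jE.
have tp2 : t <= p.*2 by clear -tp; lia.
have setE s : seq_set c s 5 = [set w in [:: c s; c s.+1; c s.+2; c s.+3; c s.+4]] by [].
have [todd|teven] := boolP (odd t).
  left; exists (a + t./2).+1; have kp : t./2 < p by clear -tp todd; lia.
  rewrite (_ : _.*2 = a.*2.+1 + t); last by clear -todd; lia.
  rewrite cy // FiP //; split=> //.
    by clear -kp pr; lia.
  have [k tE] : exists k, t = k.*2.+1 by exists t./2; clear -todd; lia.
  rewrite tE /= uphalf_double in kp *.
  have -> : (a.*2.+1 + k.*2.+1).-2 = a.*2 + k.*2 by clear; lia.
  rewrite setE; set W1 := c (a.*2 + k.*2); set W2 := c _.+4.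
  have -> : c (a.*2 + k.*2).+1 = y k.*2 by rewrite -cy; [congr c|]; clear -kp; lia.
  have -> : c (a.*2 + k.*2).+2 = y k.*2.+1 by rewrite -cy; [congr c|]; clear -kp; lia.
  have -> : c (a.*2 + k.*2).+3 = y k.*2.+2 by rewrite -cy; [congr c|]; clear -kp; lia.
  have cW1 : (k = 0 /\ W1 = v0) \/ (0 < k /\ W1 = y k.*2.-1).
    rewrite /W1; case: posnP => [->|k0]; [left|right]; rewrite ?addn0 //; split=> //.
    by rewrite -cy; [congr c|]; clear -kp k0; lia.
  have cW2 : (k = p.-1 /\ W2 = w0) \/ (k.+1 < p /\ W2 = y k.*2.+3).
    rewrite /W2; have [kE|kE] : k = p.-1 \/ k.+1 < p by clear -kp; lia.
      by left; split=> //; rewrite -cw0; congr c; clear -kE p0; lia.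
    by right; split=> //; rewrite -cy; [congr c|]; clear -kp kE; lia.
  have [kF y1F y2F y3F] := ys1 k kp; have [ky1 ky2] := ys2 k kp.
  move: (v0n) (w0n); rewrite !inE !negb_or => /and4P[vn1 vn2 vn3 vn4] /and4P[wn1 wn2 wn3 wn4].
  have yn3 i : 0 < i -> i.+2 < p.*2 -> y i != y i.+3.
    move=> i0 ip; have [i3|i3] := ltnP i.+3 (p.*2 + rho).
      by apply: yne i3; [apply: leq_trans i0; case: lam|clear; lia].
    have pE3 : i.+3 = p.*2 by clear -ip i3; lia.
    rewrite eq_sym pE3 (_ : i = p.*2.-1.-2); last by clear -pE3; lia.
    by apply: yp4; clear -pE3 i0; lia.
  have n1 : W1 != y k.*2.+2.
    case: cW1 => [[k0 ->]|[k0 ->]]; first by rewrite k0.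
    have -> : k.*2.+2 = k.*2.-1.+3 by clear -k0; lia.
    by apply: yn3; clear -k0 kp; lia.
  have n2 : y k.*2 != W2.
    case: cW2 => [[kE ->]|[kE ->]].
      by rewrite eq_sym (_ : k.*2 = p.*2.-2) //; clear -kE; lia.
    have [->|k0] := posnP k; first by apply: yp3; clear -kE; lia.
    by apply: yn3; clear -k0 kE; lia.
  have n3 : W1 != W2.
    case: cW1 => [[k0 ->]|[k0 ->]]; case: cW2 => [[kE ->]|[kE ->]].
    - by move: wn4; rewrite /z ifT 1?eq_sym //; clear -kE k0 p0; lia.
    - by rewrite k0.
    - move: wn4; rewrite /z ifF 1?eq_sym //; last by clear -kE k0; lia.
      by rewrite (_ : k.*2.-1 = p.*2.-1.-2) //; clear -kE; lia.
    apply: yne; [apply: (@leq_trans 1); [by case: lam|]|..]; clear -k0 kE; lia.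
  rewrite -(hF0 k kp); apply: window_bound => //.
  - have n4 : (W1 != y k.*2) && (W1 != y k.*2.+1).
      case: cW1 => [[k0 ->]|[k0 ->]]; first by rewrite k0 vn1 vn2.
      by rewrite !yprop //; clear -k0 kp; lia.
    have n5 : (y k.*2.+1 != W2) && (y k.*2.+2 != W2).
      case: cW2 => [[kE ->]|[kE ->]]; last by rewrite !yprop //; clear -kE; lia.
      rewrite ![_ == w0]eq_sym (_ : k.*2.+2 = p.*2) 1?(_ : k.*2.+1 = p.*2.-1) ?wn1 ?wn2 //;
        by clear -kE p0; lia.
    case/andP: n4 => n4 n4'; case/andP: n5 => n5 n5'.
    rewrite /= !inE !negb_or n1 n2 n3 n4 n4' n5 n5' !yprop //; by clear -kp; lia.
  - by rewrite hF0 //; apply: hP; clear -kp; lia.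
  - case: cW1 => [[k0 ->]|[k0 ->]]; last by rewrite (negPf (ky1 k0)).
    rewrite k0 => /v0F[l ->]; split=> //; case: cW2 => [[kE ->]|[kE ->]].
      (* If [v0] and [w0] both recurred in [F0 0], the block would be a single vertex without chosen
         end edges, which [p1] excludes. *)
      have p1' : p = 1 by clear -kE k0 p0; lia.
      have r1 : rho by move: (p1 p1'); rewrite (negPf l).
      by apply/negP=> h; move: (w0F); rewrite -kE k0 h r1 => /(_ isT)[].
    by have := ky2 kE; rewrite k0.
  - case: cW2 => [[kE ->]|[kE ->]]; last by rewrite (negPf (ky2 kE)).
    by rewrite {1}kE => /w0F[_]; rewrite -kE.
right; exists (a + t./2).
have [k tE] : exists k, t = k.*2 by exists t./2; clear -teven; lia.
rewrite tE doubleK in tp tp2 *.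
have -> : (a + k).*2.+1 = a.*2.+1 + k.*2 by clear; lia.
rewrite cy // setE.
(* A chosen edge is the left end edge ([k = 0]), an inner edge, or the right end edge ([k = p]); the
   end edges are covered by [end_extension]. *)
have [k0|k0] := posnP k.
  have l : lam by move: tp; rewrite k0; clear; case: lam.
  have [_ _ _ _ <-] := vlam l.
  rewrite k0 addn0 FiL // -[in Fi a.+1](addn0 a) FiP // ce1 //.
  have -> : a.*2.-1.+1 = a.*2 by have := a0 l; clear; lia.
  rewrite cv0 -[in c a.*2.+1](addn0 a.*2.+1) cy //.
  rewrite -[in c a.*2.+2](addn1 a.*2.+1) cy //; last by clear -p0; lia.
  rewrite -[in c a.*2.+3](addn2 a.*2.+1) cy //.
  by split; [have := a0 l; clear -pr p0; lia | | rewrite [F1 :|: _]setUC].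
have -> : (a + k).*2.-1 = a.*2.+1 + k.*2.-2 by clear -k0; lia.
rewrite -!addnS (addnS a k).
have kE : [/\ k.*2.-2.+1 = k.*2.-1, k.*2.-2.+2 = k.*2 & (a + k) = (a + k.-1).+1].
  by split; clear -k0; lia.
have kE2 : k.*2.-2.+1 = k.*2.-1 /\ k.*2.-2.+2 = k.*2 by split; clear -k0; lia.
case: kE => -> -> ak.
have FiK : Fi (a + k) = F0 k.-1 by rewrite ak FiP //; clear -tp2 k0; lia.
rewrite !(@cy k.*2.-2, @cy k.*2.-1, @cy k.*2) //; try by clear -tp2; lia.
have [kp|kp] := ltnP k p.
  rewrite FiK FiP // !cy; try by clear -kp; lia.
  have := ys3 k.-1; rewrite prednK // => /(_ kp).
  have -> : k.-1.*2 = k.*2.-2 by clear -k0; lia.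
  have -> : seq_set y k.*2.-2 5 = [set w in [:: y k.*2.-2; y k.*2.-1; y k.*2; y k.*2.+1; y k.*2.+2]].
    by rewrite /seq_set /=; case: kE2 => -> ->.
  by move=> <-; split=> //; clear -pr k0 kp; lia.
have kp' : k = p by clear -kp tp2; lia.
have l : rho by move: tp; rewrite kp'; clear; case: rho; rewrite // addn0; lia.
have [_ _ _ _ cov] := wrho l.
rewrite FiK kp' FiR // -cov.
split=> //; first by move: pr; rewrite l; clear -p0; lia.
have -> : c (a.*2.+1 + p.*2.+1) = w0 by rewrite -cw0; congr c; clear; lia.
have -> : c (a.*2.+1 + p.*2.+2) = e2 by rewrite -ce2 //; congr c; clear; lia.
congr (_ :|: _); apply/setP=> w; rewrite !inE.
by do 5?case: (w == _); rewrite ?orbT.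
Qed.
End LineColouring.

(** * From the line to a total colouring of the caterpillar *)

Section Spine.
Variables (V : finType) (e : rel V) (x0 : V) (U : seq V) (r : nat).
Hypotheses (esym : symmetric e) (eirr : irreflexive e).
Hypotheses (uU : uniq U) (sU : size U = r.+2).
Hypothesis eU : {in U &, forall v w,
  e v w = (index w U == (index v U).+1) || (index v U == (index w U).+1)}.
Hypothesis eH : forall v, v \notin U ->
  exists w, [/\ w \in U, 0 < index w U <= r & forall x, e v x = (x == w)].

Let u i := nth x0 U i.

(* For [v] outside [U] the only neighbour of [v]; junk otherwise. *)
Definition anchor v := if [pick w | e v w] is Some w then index w U else 0.
Definition hanging i := [set v | (v \notin U) && (anchor v == i)].

Lemma spine_mem i : i <= r.+1 -> u i \in U.
Proof. by move=> ir; rewrite mem_nth // sU. Qed.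

Lemma index_u i : i <= r.+1 -> index (u i) U = i.
Proof. by move=> ir; rewrite index_uniq // sU. Qed.

Lemma u_index v : v \in U -> u (index v U) = v.
Proof. exact: nth_index. Qed.

Lemma index_le v : v \in U -> index v U <= r.+1.
Proof. by rewrite -index_mem sU. Qed.

Lemma spine_adj i j : i <= r.+1 -> j <= r.+1 -> e (u i) (u j) = (j == i.+1) || (i == j.+1).
Proof. by move=> ir jr; rewrite eU ?spine_mem // !index_u. Qed.

Lemma anchorP v : v \notin U -> 0 < anchor v <= r /\ forall x, e v x = (x == u (anchor v)).
Proof.
move=> vU; have [w [wU wr ew]] := eH vU; rewrite /anchor.
by case: pickP => [w'|/(_ w)]; rewrite ew ?eqxx // => /eqP->; rewrite u_index.
Qed.

Definition mk_edge v w (h : e v w) : edge e.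
Proof.
by exists [set v; w]; apply/existsP; exists v; apply/existsP; exists w; rewrite h eqxx.
Defined.

Lemma edge_cases (f : edge e) :
  (exists2 i, i <= r & val f = [set u i; u i.+1]) \/
  (exists2 v, v \notin U & val f = [set v; u (anchor v)]).
Proof.
case: f => A /= /existsP[v /existsP[w /andP[vw /eqP->]]].
case: (boolP (v \in U)) => vU; last first.
  by right; exists v => //; move: vw; have [_ ->] := anchorP vU => /eqP->.
case: (boolP (w \in U)) => wU; last first.
  right; exists w => //; move: vw; rewrite esym; have [_ ->] := anchorP wU => /eqP->.
  by rewrite setUC.
left; have := vw; rewrite eU // => /orP[]/eqP wv.
  by exists (index v U); [have := index_le wU; rewrite wv|rewrite -wv !u_index].
by exists (index w U); [have := index_le vU; rewrite wv|rewrite -wv !u_index // setUC].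
Qed.

Section Colour.
Variables (m : nat) (c : nat -> 'I_m) (F : nat -> {set 'I_m}).
Hypothesis m6 : 6 <= m.
Hypothesis cprop : forall j k, j < k <= j + 2 -> k <= r.*2.+2 -> c j != c k.
Hypothesis cF : forall i, 0 < i -> [/\ #|F i| = #|hanging i|, c i.*2.-1 \notin F i,
  c i.*2 \notin F i & c i.*2.+1 \notin F i].

(* The leaves hanging at a vertex take the colours of [F] on their edges and the
   colours missing at the vertex on themselves, in the order of enumeration. *)
Let rk v := index v (enum (hanging (anchor v))).
Let phi v := nth (c 0) (enum (F (anchor v))) (rk v).
Let missing i := ~: (F i :|: seq_set c i.*2.-2 5).
Let dft v := odflt (c 0) [pick z | z \notin [:: c (anchor v).*2; phi v]].
Let psi v := nth (dft v) (enum (missing (anchor v))) (rk v).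
(* For a path edge the two indices sum up to its position on the line. *)
Let cole (A : {set V}) := if [pick v in A | v \notin U] is Some v then phi v
                          else c (\sum_(v in A) index v U).
Definition spine_colour (x : element e) : 'I_m :=
  match x with
  | inl v => if v \in U then c (index v U).*2 else psi v
  | inr f => cole (val f)
  end.

Lemma rk_lt v : v \notin U -> rk v < #|hanging (anchor v)|.
Proof. by move=> vU; rewrite cardE index_mem mem_enum inE vU eqxx. Qed.

Lemma phi_in v : v \notin U -> phi v \in F (anchor v).
Proof.
move=> vU; have [/andP[a0 _] _] := anchorP vU; have [cFi _ _ _] := cF a0.
by rewrite -mem_enum mem_nth // -cardE cFi rk_lt.
Qed.

Lemma phi_inj v w : v \notin U -> w \notin U -> anchor v = anchor w -> phi v = phi w -> v = w.
Proof.
move=> vU wU vw; have [/andP[a0 _] _] := anchorP vU; have [cFi _ _ _] := cF a0.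
have := rk_lt vU; have := rk_lt wU; rewrite /phi /rk -vw -cFi cardE => h1 h2 /eqP.
rewrite nth_uniq ?enum_uniq // => /eqP; by apply: (index_inj v); rewrite mem_enum inE ?vU ?wU ?vw eqxx.
Qed.

Lemma hang_at i k : 0 < i -> k < #|hanging i| ->
  exists v, [/\ v \notin U, anchor v = i & rk v = k].
Proof.
move=> i0 ki; pose v := nth x0 (enum (hanging i)) k.
have : v \in hanging i by rewrite -mem_enum mem_nth // -cardE.
rewrite inE => /andP[vU /eqP va]; exists v; split=> //.
by rewrite /rk va index_uniq ?enum_uniq // -cardE.
Qed.

Lemma phi_onto i z : 0 < i -> z \in F i -> exists v, [/\ v \notin U, anchor v = i & phi v = z].
Proof.
move=> i0 zF; have [cFi _ _ _] := cF i0.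
have zi : index z (enum (F i)) < #|hanging i| by rewrite -cFi cardE index_mem mem_enum.
have [v [vU va vk]] := hang_at i0 zi; exists v; split=> //.
by rewrite /phi vk va nth_index // mem_enum.
Qed.

(** The second hypothesis says that no more colours are missing than there are leaves at the
    vertex. *)
Lemma psi_onto i z : 0 < i -> m <= #|F i :|: seq_set c i.*2.-2 5| + #|hanging i| ->
  z \in missing i -> exists v, [/\ v \notin U, anchor v = i & psi v = z].
Proof.
move=> i0 hi zF.
have zi : index z (enum (missing i)) < #|hanging i|.
  have : index z (enum (missing i)) < #|missing i| by rewrite cardE index_mem mem_enum.
  move=> /leq_trans; apply.
  have := card_compl (F i :|: seq_set c i.*2.-2 5).
  by rewrite cardsT card_ord -/(missing i); clear -hi; lia.
have [v [vU va vk]] := hang_at i0 zi; exists v; split=> //.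
by rewrite /psi vk va nth_index // mem_enum.
Qed.

Lemma psi_neq v : v \notin U -> psi v != c (anchor v).*2 /\ psi v != phi v.
Proof.
move=> vU; have [/andP[a0 _] _] := anchorP vU.
have [kl|kl] := ltnP (rk v) #|missing (anchor v)|.
  have : psi v \in missing (anchor v) by rewrite -mem_enum mem_nth // -cardE.
  rewrite in_setC in_setU negb_or => /andP[pF pW]; split; last first.
    by apply: contraNneq pF => ->; exact: phi_in.
  apply: contraNneq pW => ->; apply/seq_setP.
  by exists (anchor v).*2 => //; clear -a0; lia.
(* The missing colours are used up before this leaf; it takes the default colour, which differs from
   those of its neighbour and its edge. *)
rewrite /psi nth_default -?cardE // /dft; case: pickP => [z|H] /=.
  by rewrite !inE negb_or => /andP[].
have [|z] := @ex_notin _ [:: c (anchor v).*2; phi v]; last by rewrite H.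
by rewrite cardsT card_ord /=; apply: leq_trans m6.
Qed.

Lemma cole_path i : i <= r -> cole [set u i; u i.+1] = c i.*2.+1.
Proof.
move=> ir; rewrite /cole; case: pickP => [v|_].
  by rewrite !inE => /andP[/orP[]/eqP->]; rewrite spine_mem // leqW.
rewrite big_setU1 ?big_set1 /= ?index_u // ?leqW //.
  by congr c; clear; lia.
rewrite inE; apply/eqP=> h; have := index_u (leqW ir); have := @index_u i.+1 ir.
by rewrite h => ->; clear; lia.
Qed.

Lemma cole_leaf v : v \notin U -> cole [set v; u (anchor v)] = phi v.
Proof.
move=> vU; have [/andP[_ ar] _] := anchorP vU.
rewrite /cole; case: pickP => [w|/(_ v)]; last by rewrite !inE eqxx vU.
by rewrite !inE => /andP[/orP[/eqP->//|/eqP->]]; rewrite spine_mem // leqW.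
Qed.

Let sc := spine_colour.

Lemma sc_u i : i <= r.+1 -> sc (inl (u i)) = c i.*2.
Proof. by move=> ir; rewrite /sc /= spine_mem // index_u. Qed.

Lemma sc_leaf v : v \notin U -> sc (inl v) = psi v.
Proof. by move=> vU; rewrite /sc /= (negPf vU). Qed.

Lemma anchor_U v : v \notin U -> u (anchor v) \in U.
Proof. by move=> /anchorP[/andP[_ ar] _]; rewrite spine_mem // leqW. Qed.

Lemma sc_anchor v : v \notin U -> sc (inl (u (anchor v))) = c (anchor v).*2.
Proof. by move=> /anchorP[/andP[_ ar] _]; rewrite sc_u // leqW. Qed.

Lemma colour_vertices v w : e v w -> sc (inl v) != sc (inl w).
Proof.
have half v' w' : e v' w' -> v' \notin U -> sc (inl v') != sc (inl w').
  move=> + vU; have [_ ->] := anchorP vU => /eqP->.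
  by rewrite sc_leaf // sc_anchor //; case: (psi_neq vU).
case: (boolP (v \in U)) => vU vw; last exact: half.
case: (boolP (w \in U)) => wU; last by rewrite eq_sym half // esym.
rewrite /sc /= vU wU; have := index_le vU; have := index_le wU.
by move: vw; rewrite eU // => /orP[]/eqP-> h1 h2; [|rewrite eq_sym]; apply: cprop;
  clear -h1 h2; lia.
Qed.

Lemma colour_incident v (f : edge e) : v \in val f -> sc (inl v) != sc (inr f).
Proof.
rewrite (_ : sc (inr f) = cole (val f)) //; case: (edge_cases f) => [[i ir ->]|[w wU ->]].
  have ir1 := leqW ir; rewrite cole_path // !inE => /orP[]/eqP->; rewrite sc_u //; [|rewrite eq_sym];
    by apply: cprop; clear -ir; lia.
rewrite cole_leaf // !inE => /orP[]/eqP->; first by rewrite sc_leaf //; case: (psi_neq wU).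
rewrite sc_anchor //; have [/andP[a0 _] _] := anchorP wU; have [_ _ cn _] := cF a0.
by apply: contraNneq cn => ->; exact: phi_in.
Qed.

Lemma colour_edges (f g : edge e) v : f != g -> v \in val f -> v \in val g ->
  sc (inr f) != sc (inr g).
Proof.
have mixed i w : i <= r -> w \notin U -> v \in [set u i; u i.+1] ->
    v \in [set w; u (anchor w)] -> c i.*2.+1 != phi w.
  move=> ir wU; have [/andP[a0 ar] _] := anchorP wU; have [_ cn1 _ cn2] := cF a0.
  rewrite !inE => vi /orP[]/eqP vw.
    by case/orP: vi => /eqP vi; move: wU; rewrite -vw vi spine_mem // leqW.
  have : anchor w = i \/ anchor w = i.+1.
    have ir1 := leqW ir; rewrite -(index_u (leqW ar)) -vw.
    by case/orP: vi => /eqP->; rewrite index_u //; auto.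
  case=> wi; rewrite wi in cn1 cn2.
    by apply: contraNneq cn2 => ->; rewrite -wi phi_in.
  by apply: contraNneq cn1; rewrite doubleS /= => ->; rewrite -wi phi_in.
rewrite -val_eqE /sc /=; case: (edge_cases f) (edge_cases g) => [[i ir ->]|[w wU ->]] [[j jr ->]|[w' wU' ->]].
- have ir1 := leqW ir; have jr1 := leqW jr; rewrite !cole_path // !inE => ij vi vj.
  have ni : index v U = i \/ index v U = i.+1.
    by case/orP: vi => /eqP->; rewrite index_u //; auto.
  have nj : index v U = j \/ index v U = j.+1.
    by case/orP: vj => /eqP->; rewrite index_u //; auto.
  have [iE|[iE|iE]] : i = j \/ i = j.+1 \/ j = i.+1 by clear -ni nj; lia.
  + by rewrite iE eqxx in ij.
  + by rewrite iE eq_sym; apply: cprop; clear -ir iE; lia.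
  + by rewrite iE; apply: cprop; clear -jr iE; lia.
- by move=> _ vi vw; rewrite cole_path // cole_leaf // mixed.
- by move=> _ vw vi; rewrite cole_path // cole_leaf // eq_sym mixed.
move=> ww vw vw'; rewrite !cole_leaf //; apply: contraNneq ww => pp.
have aa : anchor w = anchor w' \/ w = w'.
  move: vw vw'; rewrite !inE => /orP[]/eqP-> /orP[]/eqP wE.
  - by right.
  - by move: wU; rewrite wE anchor_U.
  - by move: wU'; rewrite -wE anchor_U.
  have [/andP[_ ar] _] := anchorP wU; have [/andP[_ ar'] _] := anchorP wU'.
  by left; rewrite -(index_u (leqW ar)) wE index_u // leqW.
by case: aa => [aa|->//]; rewrite (phi_inj wU wU' aa pp).
Qed.

Lemma spine_proper x y : tadj x y -> sc x != sc y.
Proof.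
case: x y => [v|f] [w|g] /=; [exact: colour_vertices|exact: colour_incident|rewrite eq_sym; exact: colour_incident|].
case/andP=> fg /set0Pn[v]; rewrite inE => /andP[vf vg]; exact: (colour_edges fg vf vg).
Qed.

Lemma b_chromaticP x : (forall z, z != sc x -> exists2 y, tadj x y & sc y = z) ->
  b_chromatic [ffun x => sc x] x.
Proof.
move=> H; apply/eqP/setP=> z; rewrite !inE ffunE; apply/imsetP/idP => [[y]|/H[y xy <-]].
  by rewrite inE ffunE => xy ->; rewrite eq_sym spine_proper.
by exists y; rewrite ?inE // ffunE.
Qed.

Definition leaf_edge v (vU : v \notin U) : edge e.
Proof. by apply: (@mk_edge v (u (anchor v))); have [_ ->] := anchorP vU. Defined.

Definition path_edge i (ir : i <= r) : edge e.
Proof. by apply: (@mk_edge (u i) (u i.+1)); rewrite spine_adj ?eqxx // leqW. Defined.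

Lemma sc_path_edge i (ir : i <= r) : sc (inr (path_edge ir)) = c i.*2.+1.
Proof. exact: cole_path. Qed.

Lemma sc_leaf_edge v (vU : v \notin U) : sc (inr (leaf_edge vU)) = phi v.
Proof. exact: cole_leaf. Qed.

(** Colours of [F i] are seen on pendant edges, those of the window on the spine, and the missing
    ones on leaves. *)
Lemma b_vertex i : 0 < i <= r -> m <= #|F i :|: seq_set c i.*2.-2 5| + #|hanging i| ->
  b_chromatic [ffun x => sc x] (inl (u i)).
Proof.
case/andP=> i0 ir hi; apply: b_chromaticP => z; rewrite sc_u ?leqW // => zi.
case: (boolP (z \in F i)) => zF.
  have [v [vU va <-]] := phi_onto i0 zF.
  by exists (inr (leaf_edge vU)); rewrite ?sc_leaf_edge //= !inE va eqxx orbT.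
case: (boolP (z \in seq_set c i.*2.-2 5)) => zW; last first.
  have zM : z \in missing i by rewrite in_setC in_setU negb_or zF.
  have [v [vU va <-]] := psi_onto i0 hi zM.
  by exists (inl v); rewrite ?sc_leaf //= esym; have [_ ->] := anchorP vU; rewrite va eqxx.
case: i i0 ir hi zi zF zW => // i _ ir hi zi zF /seq_setP[j hj zj].
have : [|| j == i.*2, j == i.*2.+1, j == i.+1.*2, j == i.+1.*2.+1 | j == i.+2.*2] by clear -hj; lia.
case/or4P=> [/eqP jE|/eqP jE|/eqP jE|/orP[]/eqP jE]; rewrite jE in zj.
- by exists (inl (u i)); rewrite ?sc_u //= ?spine_adj ?eqxx ?orbT // ?leqW // ltnW.
- by exists (inr (path_edge (ltnW ir))); rewrite ?sc_path_edge //= !inE eqxx orbT.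
- by rewrite zj eqxx in zi.
- by exists (inr (path_edge ir)); rewrite ?sc_path_edge //= !inE eqxx.
- by exists (inl (u i.+2)); rewrite ?sc_u //= ?spine_adj ?eqxx // leqW.
Qed.

Lemma b_edge i (ir : i <= r) : 0 < i < r ->
  F i :|: F i.+1 :|: seq_set c i.*2.-1 5 = setT ->
  b_chromatic [ffun x => sc x] (inr (path_edge ir)).
Proof.
case/andP=> i0 ir' hi; apply: b_chromaticP => z; rewrite sc_path_edge => zi.
have tl v (vU : v \notin U) : anchor v = i \/ anchor v = i.+1 ->
    tadj (inr (path_edge ir) : element e) (inr (leaf_edge vU)).
  move=> va; rewrite /= -val_eqE /=; apply/andP; split.
    apply: contraNneq vU => /setP/(_ v); rewrite !inE eqxx /=.
    by case/orP=> /eqP->; rewrite spine_mem // leqW.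
  by apply/set0Pn; exists (u (anchor v)); rewrite !inE eqxx orbT; case: va => ->; rewrite eqxx ?orbT.
have tp j (jr : j <= r) k : k <= r.+1 -> i != j -> u k \in [set u i; u i.+1] -> u k \in [set u j; u j.+1] ->
    tadj (inr (path_edge ir) : element e) (inr (path_edge jr)).
  move=> kr ij ki kj; rewrite /= -val_eqE /=; apply/andP; split; last first.
    by apply/set0Pn; exists (u k); rewrite in_setI ki kj.
  apply: contraNneq ij => /setP ij; have := ij (u i); have := ij (u i.+1).
  rewrite !inE !eqxx orbT /= !nth_uniq ?sU //; clear -jr ir; lia.
have : z \in [set: 'I_m] by rewrite inE.
rewrite -hi !in_setU => /orP[/orP[]|/seq_setP[j hj zj]].
- by move=> /(phi_onto i0)[v [vU va <-]]; exists (inr (leaf_edge vU)); rewrite ?sc_leaf_edge ?tl //; left.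
- by move=> /phi_onto[//|v [vU va <-]]; exists (inr (leaf_edge vU)); rewrite ?sc_leaf_edge ?tl //; right.
have : [|| j == i.-1.*2.+1, j == i.*2, j == i.*2.+1, j == i.+1.*2 | j == i.+1.*2.+1] by clear -hj i0; lia.
case/or4P=> [/eqP jE|/eqP jE|/eqP jE|/orP[]/eqP jE]; rewrite jE in zj.
- have ir1 : i.-1 <= r by clear -ir; lia.
  exists (inr (path_edge ir1)); rewrite ?sc_path_edge //; apply: (@tp _ _ i); rewrite ?inE ?prednK ?eqxx ?orbT ?leqW //.
  by clear -i0; lia.
- by exists (inl (u i)); rewrite ?sc_u ?leqW //= !inE eqxx.
- by rewrite zj eqxx in zi.
- by exists (inl (u i.+1)); rewrite ?sc_u ?leqW //= !inE eqxx orbT.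
- exists (inr (path_edge ir')); rewrite ?sc_path_edge //; apply: (@tp _ _ i.+1); rewrite ?inE ?eqxx ?orbT ?leqW //.
  by clear; lia.
Qed.

Lemma spine_b_colouring :
  (forall z, (exists i, [/\ 0 < i <= r, c i.*2 = z
                & m <= #|F i :|: seq_set c i.*2.-2 5| + #|hanging i|]) \/
             (exists i, [/\ 0 < i < r, c i.*2.+1 = z
                & F i :|: F i.+1 :|: seq_set c i.*2.-1 5 = setT])) ->
  total_b_colouring [ffun x => sc x].
Proof.
move=> H; have bz z : exists x, (sc x == z) && b_chromatic [ffun x => sc x] x.
  case: (H z) => [[i [ir <- hi]]|[i [ir <- hi]]].
    by exists (inl (u i)); rewrite b_vertex // sc_u ?eqxx // leqW //; case/andP: ir.
  have ir' : i <= r by clear -ir; lia.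
  by exists (inr (path_edge ir')); rewrite b_edge // sc_path_edge eqxx.
apply/andP; split; last first.
  by apply/forallP=> z; apply/existsP; have [x hx] := bz z; exists x; rewrite ffunE.
apply/andP; split.
  by apply/forallP=> z; apply/existsP; have [x /andP[hx _]] := bz z; exists x; rewrite ffunE.
apply/forallP=> x; apply/forallP=> y; apply/implyP=> /spine_proper.
by rewrite !ffunE.
Qed.

End Colour.
End Spine.

(** * Total degrees and the number [m_t] *)

Lemma sorted_geq_nth (s : seq nat) k i : sorted geq s -> i < size s ->
  (k <= nth 0 s i) = (i < count (leq k) s).
Proof.
elim: s i => [|d s IH] i //= pd; have sd := path_sorted pd.
(* Once the head is below [k], the whole tail of a decreasing list is. *)
have kd : (k <= d) = false -> count (leq k) s = 0.
  move=> kd; apply/eqP; rewrite -leqn0 leqNgt -has_count; apply/negP=> /hasP[d' sd' kd'].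
  have /allP/(_ d' sd') : all (geq d) s by apply: order_path_min pd; move=> x y z; rewrite /geq /=; lia.
  by rewrite /= in kd' *; lia.
case: i => [_|i] /=; first by case kd': (k <= d) => //; rewrite kd.
by rewrite ltnS => si; rewrite IH //; case kd': (k <= d) => //; rewrite kd.
Qed.

Section Degrees.
Variables (V : finType) (e : rel V).
Hypotheses (symE : symmetric e) (eirr : irreflexive e).

Definition edges_at v : {set edge e} := [set f : edge e | v \in val f].

Lemma edge_ends (f : edge e) v : v \in val f -> exists2 w, e v w & val f = [set v; w].
Proof.
case: f => A /= /existsP[x /existsP[y /andP[xy /eqP->]]]; rewrite !inE => /orP[]/eqP->.
  by exists y.
by exists x; rewrite 1?symE // setUC.
Qed.

Lemma card_edges_at v : #|edges_at v| = degree e v.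
Proof.
rewrite /degree -(card_imset _ val_inj).
have <- : [set [set v; w] | w in [set w | e v w]] = val @: edges_at v.
  apply/setP=> A; apply/imsetP/imsetP => [[w]|[f]]; rewrite inE.
    by move=> vw ->; exists (mk_edge vw); rewrite // inE /= !inE eqxx.
  by move=> /edge_ends[w vw fE] ->; exists w; rewrite ?inE.
rewrite card_in_imset // => w w'; rewrite !inE => vw vw' /setP/(_ w).
rewrite !inE eqxx orbT => /esym/orP[]/eqP // wv; by rewrite wv eirr in vw.
Qed.

Lemma tdeg_vertex v : tdeg (inl v : element e) = (degree e v).*2.
Proof.
rewrite /tdeg.
have -> : tnbr (inl v : element e) = inl @: [set w | e v w] :|: inr @: edges_at v.
  apply/setP=> -[w|f]; rewrite !inE /=.
    rewrite mem_imset ?inE; last by move=> ? ? [].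
    by rewrite [X in _ || X](_ : _ = false) ?orbF //; apply/imsetP=> -[].
  rewrite orbC mem_imset ?inE; last by move=> ? ? [].
  by rewrite [X in _ || X](_ : _ = false) ?orbF //; apply/imsetP=> -[].
rewrite cardsU disjoint_setI0 ?cards0; last first.
  by apply/pred0P=> x /=; apply/andP=> -[/imsetP[w _ ->] /imsetP[]].
by rewrite !card_imset ?card_edges_at -/(degree e v); first lia; move=> ? ? [].
Qed.

(** The incident edges of the two ends share only [f]. Leaving [f] out loses two in the sum of
    degrees, and the two end vertices make up for it. *)
Lemma tdeg_edge (f : edge e) v w : e v w -> val f = [set v; w] ->
  tdeg (inr f : element e) = degree e v + degree e w.
Proof.
move=> vw fE; have vnw : v != w by apply: contraTneq vw => ->; rewrite eirr.
have -> : tdeg (inr f : element e) = #|val f| + #|(edges_at v :|: edges_at w) :\ f|.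
  rewrite /tdeg.
  have -> : tnbr (inr f : element e) =
      inl @: val f :|: inr @: ((edges_at v :|: edges_at w) :\ f).
    apply/setP=> -[x|g]; rewrite !inE /=.
      rewrite mem_imset ?inE; last by move=> ? ? [].
      by rewrite [X in _ || X](_ : _ = false) ?orbF //; apply/imsetP=> -[].
    rewrite orbC mem_imset ?inE; last by move=> ? ? [].
    rewrite [X in _ || X](_ : _ = false) ?orbF; last by apply/imsetP=> -[].
    rewrite eq_sym; congr andb; rewrite fE; apply/set0Pn/orP => [[x]|].
      by rewrite !inE => /andP[/orP[]/eqP->]; [left|right].
    by case=> h; [exists v|exists w]; rewrite !inE eqxx ?orbT.
  rewrite cardsU disjoint_setI0 ?cards0; last first.
    by apply/pred0P=> x /=; apply/andP=> -[/imsetP[x' _ ->] /imsetP[]].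
  by rewrite !card_imset ?subn0 //; move=> ? ? [].
rewrite fE cards2 vnw -!card_edges_at.
have fv : f \in edges_at v by rewrite inE fE !inE eqxx.
have fw : f \in edges_at w by rewrite inE fE !inE eqxx orbT.
have EI : edges_at v :&: edges_at w = [set f].
  apply/setP=> g; rewrite in_setI in_set1; apply/andP/eqP => [[gv gw]|->//].
  apply: val_inj; rewrite !inE in gv gw; have [x vx gE] := edge_ends gv.
  rewrite gE fE; congr [set v; _]; move: gw; rewrite gE !inE eq_sym (negPf vnw) /=.
  by move=> /eqP.
have := cardsD1 f (edges_at v :|: edges_at w); rewrite inE fv /= => H.
by apply: etrans (cardsUI (edges_at v) (edges_at w)); rewrite EI cards1 H addn1.
Qed.

Definition high_elements k := [set x : element e | k <= tdeg x].

Lemma count_tdeg k : count (leq k) (tdeg_seq e) = #|high_elements k|.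
Proof.
rewrite /tdeg_seq (permP (permEl (perm_sort _ _))) count_map.
by rewrite cardE -size_filter /enum_mem -enumT /enum_mem -!filter_predI /=;
  congr size; apply: eq_filter => x /=; rewrite !inE ?andbT.
Qed.

Lemma size_tdeg_seq : size (tdeg_seq e) = #|{: element e}|.
Proof. by rewrite /tdeg_seq size_sort size_map -cardE. Qed.

Lemma tdeg_seq_sorted : sorted geq (tdeg_seq e).
Proof. by apply: sort_sorted => x y; rewrite /geq /=; lia. Qed.

(** Together with [m_t_le] this characterises [m_t e] as the largest [k] such that at least [k]
    elements have total degree at least [k - 1]. *)
Lemma m_t_ge k : k <= #|high_elements k.-1| -> k <= m_t e.
Proof.
case: k => // k /= hk.
have ks : k < size (tdeg_seq e).
  by rewrite size_tdeg_seq; apply: leq_trans hk (max_card _).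
have := @leq_bigmax_cond _ (fun i : 'I_(size (tdeg_seq e)) => i <= nth 0 (tdeg_seq e) i)
  (fun i => i.+1) (Ordinal ks).
by apply; rewrite /= sorted_geq_nth ?tdeg_seq_sorted // count_tdeg.
Qed.

Lemma m_t_le : m_t e <= #|high_elements (m_t e - 1)|.
Proof.
rewrite subn1 /m_t; apply: (big_ind (fun n => n <= #|high_elements n.-1|)) => //.
  by move=> x y hx hy; rewrite /maxn; case: ifP.
move=> i; rewrite sorted_geq_nth ?tdeg_seq_sorted // count_tdeg //.
Qed.

(** A total b-chromatic element sees [k - 1] colours, so every colour occurs on an element of total
    degree at least [k - 1]. *)
Lemma phi_t_le : phi_t e <= m_t e.
Proof.
apply/bigmax_leqP=> -[[|k] kN] //= /existsP[c /andP[_ /forallP bc]].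
apply: m_t_ge => /=.
have cT : c @: high_elements k = setT.
  apply/setP=> z; rewrite inE; have /existsP[x /andP[/eqP<- /eqP bx]] := bc z.
  apply: imset_f; rewrite inE /tdeg.
  apply: leq_trans (leq_imset_card c _); by rewrite bx cardsC1 card_ord.
by have := leq_imset_card c (high_elements k); rewrite cT cardsT card_ord.
Qed.

Lemma phi_t_ge k (c : {ffun element e -> 'I_k}) : k <= #|{: element e}| ->
  total_b_colouring c -> k <= phi_t e.
Proof.
rewrite -ltnS => kN bc.
have := @leq_bigmax_cond _ (fun k : 'I_(#|{: element e}|.+1) =>
  [exists c : {ffun element e -> 'I_k}, total_b_colouring c]) (fun k => k) (Ordinal kN).
by apply; apply/existsP; exists c.
Qed.

End Degrees.

(** * Choosing [m] dense elements on the line *)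

Section Interval.
Variables (C : finType) (L : nat -> nat) (r lo hi : nat).
Local Notation m := #|[set: C]|.
(** Density in terms of leaf numbers: vertex [i] has total degree [2 * L i + 4], the edge after it
    [L i + L i.+1 + 4], and the threshold is [m - 1]. *)
Let Dv i := m - 5 <= (L i).*2.
Let De i := m - 5 <= L i + L i.+1.
Hypotheses (m6 : 6 <= m) (hL : forall i, L i <= m - 5).
Hypotheses (lo0 : 0 < lo) (lohi : lo <= hi) (hir : hi < r).
Hypothesis DeP : forall i, 0 < i < r -> De i = (lo <= i <= hi).
Hypothesis DvP : forall i, lo < i <= hi -> Dv i.

(* First and last position of the dense path without its non-dense end vertices. *)
Let A0 := lo.*2 + ~~ Dv lo.
Let B0 := hi.*2.+1 + Dv hi.+1.
Let Iall := [seq i <- iota 1 r | Dv i && ~~ (lo <= i <= hi.+1)].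
Hypothesis hcard : m <= B0.+1 - A0 + size Iall.

Lemma Dv_path i : A0 <= i.*2 <= B0 -> Dv i.
Proof.
rewrite /A0 /B0 => h; have [ij|ij] := boolP (lo < i <= hi); first exact: DvP.
have [iE|iE] : i = lo \/ i = hi.+1 by clear -h ij lohi; case: (Dv lo) h; case: (Dv hi.+1); lia.
  by apply: contraTT h; rewrite iE => /negPf->; clear; lia.
by apply: contraTT h; rewrite iE => /negPf->; clear; lia.
Qed.

Lemma De_path i : A0 <= i.*2.+1 <= B0 -> De i.
Proof.
move=> h; rewrite DeP; move: h; rewrite /A0 /B0; clear -hir lohi lo0; case: (Dv lo); case: (Dv hi.+1); lia.
Qed.

(** Adding the two vertex inequalities shows that the edge between adjacent dense vertices is
    dense. *)
Lemma dense_adjacent i : 0 < i < r -> Dv i -> Dv i.+1 -> lo <= i <= hi.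
Proof. by move=> ir h1 h2; rewrite -DeP // /De; move: h1 h2; rewrite /Dv; clear; lia. Qed.

Lemma mem_Iall i : i \in Iall -> [/\ 0 < i <= r, Dv i & (i < lo) || (hi.+1 < i)].
Proof.
rewrite mem_filter mem_iota => /andP[/andP[Di li] ir]; split=> //.
by clear -li; lia.
Qed.

Lemma Iall_far i : i \in Iall -> (i.*2.+2 < A0) || (B0.+2 < i.*2).
Proof.
move=> /mem_Iall[ir Di]; rewrite /A0 /B0 => /orP[il|ih]; apply/orP; [left|right].
  have [h|h] := boolP (Dv lo); last by clear -il; lia.
  have [iE|iE] := eqVneq i.+1 lo; last by clear -il iE; lia.
  have /dense_adjacent : 0 < i < r by clear -ir iE lohi hir; lia.
  by move/(_ Di); rewrite iE => /(_ h); clear -iE; lia.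
have [h|h] := boolP (Dv hi.+1); last by clear -ih; lia.
have [iE|iE] := eqVneq i hi.+2; last by clear -ih iE; lia.
have /dense_adjacent : 0 < hi.+1 < r by clear -ir iE; lia.
by move/(_ h); rewrite -iE => /(_ Di); clear; lia.
Qed.

(* When the block is a proper part of the dense path it must start with a vertex:
   a block starting and ending with edges may leave no room for the [F i]. *)
Lemma interval_colouring_aux A B (I : seq nat) :
  A0 <= A -> A < B -> B <= B0 -> uniq I -> {subset I <= Iall} ->
  B.+1 - A + size I = m -> (I = [::] /\ ~~ odd A) \/ (A = A0 /\ B = B0) ->
  exists (c : nat -> C) (F : nat -> {set C}), line_solution L r c F.
Proof.
move=> hA AB hB uI sI hm hcase.
(* The first vertex position from [A] on is [a.+1.*2]; the block has an end edge on the left iff [A]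
   is odd, on the right iff [B] is odd. *)
pose a := (uphalf A).-1; pose p := B./2 - a.
have A1 : 1 < A.
  by apply: leq_trans hA; rewrite /A0; clear -lo0; lia.
have Br : B <= r.*2 by apply: leq_trans hB _; rewrite /B0; clear -hir; case: (Dv _); lia.
have AE : A = a.*2.+2 - odd A by rewrite /a; clear -A1; lia.
have BE : B = (a + p).*2 + odd B by rewrite /p /a; clear -AB; lia.
have oA : odd A -> A = A0 /\ B = B0 by case: hcase => [[_ /negPf->]|].
clearbody a p.
apply: (@line_colouring C L a p r (odd A) (odd B) I) => //.
- by clear -AE BE AB; lia.
- by clear -AE BE AB => p1; rewrite p1 in BE; lia.
- by rewrite -hm; clear -AE BE AB; lia.
- move=> i iI; have iIa := sI i iI; have [ir Di _] := mem_Iall iIa; split=> //.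
    have := Iall_far iIa; clear -AE BE hA hB; lia.
  apply/negP=> /sI/mem_Iall[ir1 Di1 _]; have ir2 : 0 < i < r by clear -ir ir1; lia.
  by have := dense_adjacent ir2 Di Di1; have [_ _] := mem_Iall iIa; clear; lia.
- by move=> i hi'; apply: Dv_path; clear -hi' AE BE hA hB; lia.
- by clear -BE Br; lia.
- by clear -AE A1; lia.
- by move=> o; apply: De_path; clear -o AE BE hA hB AB; lia.
- by move=> o; apply: De_path; clear -o AE BE hA hB AB; lia.
- move=> o aI; have aIa := sI _ aI; have [ir Di _] := mem_Iall aIa.
  (* Edge [a] is dense and the edge before it is not; since both contain vertex [a], comparing them
     gives [L a.-1 < L a.+1]. *)
  have ea : De a by apply: De_path; clear -o AE BE hA hB AB; lia.
  have a2 : 0 < a.-1 < r by clear -ir AE BE Br AB; lia.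
  have a1 : a.-1.+1 = a by clear -a2; lia.
  have := DeP a2; rewrite (_ : (lo <= a.-1 <= hi) = false).
    by rewrite /De a1; move: ea; rewrite /De; clear; lia.
  have := Iall_far aIa; have [AA _] := oA o; rewrite /A0 in AA hA *; clear -AE AA a1; lia.
- move=> o aI; have aIa := sI _ aI; have [ir Di _] := mem_Iall aIa.
  have ea : De (a + p) by apply: De_path; clear -o AE BE hA hB AB; lia.
  have a2 : 0 < (a + p).+1 < r by clear -ir AE BE Br AB; lia.
  have := DeP a2; rewrite (_ : (lo <= (a + p).+1 <= hi) = false).
    by move: ea; rewrite /De; clear; lia.
  by have := Iall_far aIa; rewrite /B0; clear -BE hB o; lia.
move=> oA1 oB1; have [AA BB] := oA oA1.
(* The block is the whole dense path and ends with an edge, so the vertex behind it is not dense. *)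
have : ~~ Dv (a + p).+1.
  apply/negP=> D; have : (a + p).+1.*2 <= B0.
    move: BB BE; rewrite /B0 oB1; case h: (Dv hi.+1) => BB BE; first by clear -BB BE; lia.
    by have e1 : (a + p).+1 = hi.+1 by [clear -BB BE; lia]; rewrite e1 h in D.
  by clear -BB BE oB1; lia.
by rewrite /Dv -ltnNge.
Qed.

Lemma interval_colouring : exists (c : nat -> C) (F : nat -> {set C}), line_solution L r c F.
Proof.
(* A dense path with a single edge has a dense end vertex, since two non-dense ends would make the
   edge non-dense. *)
have AB : A0 < B0.
  rewrite /A0 /B0; have [lh|lh] := ltnP lo hi; first by clear -lh; lia.
  have hE : hi = lo by clear -lh lohi; lia.
  rewrite hE; case h: (Dv lo); first by clear; lia.
  case h1: (Dv lo.+1); first by clear; lia.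
  have : De lo by rewrite DeP ?hE ?leqnn // lo0 -hE hir.
  by move: h h1; rewrite /De /Dv; clear; lia.
have T A B : m < B.+1 - A -> (uphalf A).*2 + m.-1 <= B by clear -m6; lia.
have [Qm|Qm] := leqP (B0.+1 - A0) m.
  apply: (interval_colouring_aux (A := A0) (B := B0) (I := take (m - (B0.+1 - A0)) Iall)) => //.
  - by rewrite take_uniq // filter_uniq ?iota_uniq.
  - by move=> i /mem_take.
  - by rewrite size_takel; clear -Qm hcard; lia.
  - by right.
(* Rounding [A0] up to a vertex position costs at most one element, and the dense path has more than
   [m]. *)
apply: (interval_colouring_aux (A := (uphalf A0).*2) (B := (uphalf A0).*2 + m.-1) (I := [::])) => //.
- by clear; lia.
- by clear -m6; lia.
- exact: T.
- by rewrite /=; clear -m6; lia.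
- by left; rewrite odd_double.
Qed.

End Interval.

(** * The central path prolonged by two leaves *)

Lemma caterpillar_spine (V : finType) (e : rel V) (P : seq V) :
  symmetric e -> irreflexive e -> caterpillar e P -> 1 < size P ->
  exists U : seq V, [/\ uniq U, size U = (size P).+2,
    {in U &, forall v w,
      e v w = (index w U == (index v U).+1) || (index v U == (index w U).+1)},
    forall v, v \notin U -> exists w, [/\ w \in U, 0 < index w U <= size P
                                      & forall x, e v x = (x == w)]
  & forall v, (v \in P) = (v \in U) && (0 < index v U <= size P)].
Proof.
move=> symE irrE [[_ _ acyc] [gP memP] leafP] sP.
have [x0 _] : exists x0, x0 \in P by case: P sP {gP memP leafP} => // x P' _; exists x; rewrite mem_head.
have [pP uP] : sorted e P /\ uniq P by case: P gP {sP memP leafP} => //= x P' /andP[-> ->].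
have nP i : i.+1 < size P -> e (nth x0 P i) (nth x0 P i.+1) by move: i; apply/sortedP.
(* A chord would close the part of [P] between its ends to a cycle with at least three vertices. *)
have chord i j : i.+1 < j -> j < size P -> ~~ e (nth x0 P i) (nth x0 P j).
  move=> ij jP; apply/negP=> eij; pose s := take (j - i).+1 (drop i P).
  have ss : size s = (j - i).+1 by rewrite size_takel // size_drop; clear -ij jP; lia.
  have us : uniq s by rewrite take_uniq // drop_uniq.
  have ps : sorted e s.
    move: pP; rewrite -(cat_take_drop i P) => /cat_sorted2[_].
    by rewrite -(cat_take_drop (j - i).+1 (drop i P)) => /cat_sorted2[].
  have ns k : k < (j - i).+1 -> nth x0 s k = nth x0 P (i + k).
    by move=> kj; rewrite nth_take // nth_drop.
  suff cs : cycle e s by have := acyc s; rewrite /ucycle cs us ss => /(_ isT); clear -ij; lia.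
  move: ss ps ns; case: s {us} => // y s [ss] /= ps ns; rewrite rcons_path ps /=.
  have <- : nth x0 P j = last y s.
    rewrite -[last y s]/(last x0 (y :: s)) -nth_last /= ss ns //.
    by congr nth; clear -ij; lia.
  by have := ns 0 isT; rewrite addn0 /= => ->; rewrite symE.
have ePP i j : i < size P -> j < size P ->
    e (nth x0 P i) (nth x0 P j) = (j == i.+1) || (i == j.+1).
  have lt i' j' : i' < j' -> j' < size P -> e (nth x0 P i') (nth x0 P j') = (j' == i'.+1).
    move=> ij jP; case: eqP => [jE|jE]; first by rewrite jE nP // -jE.
    by apply/negbTE/chord => //; clear -ij jE; lia.
  move=> iP jP; case: (ltngtP i j) => ij.
  - by rewrite lt //; case: eqP => //= _; apply/esym/eqP; clear -ij; lia.
  - by rewrite symE lt // orbC; case: eqP => //= _; apply/esym/eqP; clear -ij; lia.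
  - by rewrite ij irrE; clear; lia.
have lv v : v \notin P -> exists2 w, w \in P & forall x, e v x = (x == w).
  rewrite memP negbK => vl; have [w wP vw] := leafP v vl; exists w => // x.
  have /cards1P[w' Nv] : #|[set w | e v w]| == 1 by exact: vl.
  have Hx y : e v y = (y == w') by move/setP/(_ y): Nv; rewrite !inE.
  by move: vw; rewrite !Hx => /eqP->.
(* An end of [P] is not a leaf, so besides its only neighbour on [P] it has another one, which is
   off [P] and therefore a leaf. *)
have nl i j : i < size P -> j < size P -> e (nth x0 P i) (nth x0 P j) ->
    (forall k, k < size P -> e (nth x0 P i) (nth x0 P k) -> k = j) ->
    exists2 l, l \notin P & forall x, e l x = (x == nth x0 P i).
  move=> iP jP eij only.
  have : degree e (nth x0 P i) != 1 by have := memP (nth x0 P i); rewrite mem_nth // => /esym.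
  have jN : nth x0 P j \in [set w | e (nth x0 P i) w] by rewrite inE.
  rewrite /degree (cardsD1 (nth x0 P j)) jN add1n eqSS cards_eq0 => /set0Pn[l].
  rewrite !inE => /andP[lj el].
  have lP : l \notin P.
    apply/negP=> lP; case/eqP: lj; rewrite -(nth_index x0 lP).
    by congr nth; apply: only; rewrite ?index_mem // nth_index.
  exists l => //; have [w _ lw] := lv l lP; have := lw (nth x0 P i).
  by rewrite symE el => /esym/eqP->.
have [|||l0 l0P el0] := @nl 0 1 _ sP; first by clear -sP; lia.
- by apply: nP.
- move=> k kP; rewrite ePP //; [|clear -sP; lia]. by clear; lia.
have [||||l1 l1P el1] := @nl (size P).-1 (size P).-2; try by clear -sP; lia.
- rewrite ePP; clear -sP; lia.
- by move=> k kP; rewrite ePP //; [|clear -sP; lia]; clear -kP; lia.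
have P0 : nth x0 P 0 \in P by rewrite mem_nth // ltnW.
have s0 : 0 < size P by clear -sP; lia.
have s1 : (size P).-1 < size P by clear -sP; lia.
have l01 : l0 != l1.
  apply/eqP=> ll; have := el0 (nth x0 P 0); rewrite ll el1 eqxx => /eqP/eqP.
  by rewrite nth_uniq // => /eqP; clear -sP; lia.
(* [P] occupies the indices from 1 to [size P], with a leaf at either end. *)
pose U := l0 :: rcons P l1.
have uU : uniq U.
  by rewrite /= mem_rcons inE negb_or l01 l0P rcons_uniq l1P.
have iP v : v \in P -> index v U = (index v P).+1.
  move=> vP; rewrite /= ifF; last by apply: contraNF l0P => /eqP->.
  by rewrite -cats1 index_cat vP.
have i0 : index l0 U = 0 by rewrite /= eqxx.
have i1 : index l1 U = (size P).+1.
  by rewrite /= (negPf l01) -cats1 index_cat (negPf l1P) /= eqxx addn0.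
have UP v : v \in U -> [\/ v = l0, v \in P | v = l1].
  rewrite inE mem_rcons inE => /or3P[/eqP->|/eqP->|]; [exact: Or31|exact: Or33|exact: Or32].
have PU v : v \in P -> v \in U by move=> vP; rewrite inE mem_rcons inE vP !orbT.
exists U; split=> //.
- by rewrite /= size_rcons.
- have eP v : v \in P -> v = nth x0 P (index v P) by move=> vP; rewrite nth_index.
  have ix v : v \in P -> index v P < size P by rewrite index_mem.
  have l0w w : w \in U -> e l0 w = (index w U == 1).
    rewrite el0 => /UP[->|wP|->].
    + by rewrite i0; apply/negbTE; apply: contraNneq l0P => ->.
    + by rewrite iP // eqSS {1}(eP w wP) nth_uniq ?ix.
    + rewrite i1; have -> : (l1 == nth x0 P 0) = false by apply: contraNF l1P => /eqP->.
      by clear -sP; lia.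
  have l1w w : w \in U -> e l1 w = (index w U == size P).
    rewrite el1 => /UP[->|wP|->].
    + rewrite i0 (_ : (l0 == _) = false); first by clear -sP; lia.
      by apply: contraNF l0P => /eqP->; rewrite mem_nth //; clear -sP; lia.
    + by rewrite iP // -[in RHS](prednK s0) eqSS {1}(eP w wP) nth_uniq ?ix.
    + rewrite i1 (_ : (l1 == _) = false); first by clear; lia.
      by apply: contraNF l1P => /eqP->; rewrite mem_nth //; clear -sP; lia.
  have le w : w \in U -> index w U <= (size P).+1.
    by rewrite -index_mem /U /= size_rcons.
  move=> v w vU wU; have lev := le v vU; have lew := le w wU.
  have [->|vP|->] := UP v vU.
  + by rewrite l0w // i0; clear; lia.
  + have [->|wP|->] := UP w wU.
    * by rewrite symE l0w // i0; clear; lia.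
    * by rewrite {1}(eP v vP) {1}(eP w wP) ePP ?ix // !iP // !eqSS.
    * by rewrite symE l1w // i1; clear -lev; lia.
  + by rewrite l1w // i1; clear -lew; lia.
- move=> v vU; have [|w wP ew] := lv v; first by apply: contra vU; exact: PU.
  exists w; split=> //; first exact: PU.
  by rewrite iP //= index_mem.
move=> v; apply/idP/andP => [vP|[/UP[->|//|->]]].
- by rewrite PU // iP //= index_mem.
- by rewrite i0.
- by rewrite i1 ltnn.
Qed.

(** A walk with unit steps that turned back would repeat the number before the turn, so without
    repetition it is monotone. *)
Lemma unit_step_path x s :
  path (fun i j => (j == i.+1) || (i == j.+1)) x s -> uniq (x :: s) ->
  x :: s = iota x (size s).+1 \/
  size s <= x /\ x :: s = rev (iota (x - size s) (size s).+1).
Proof.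
elim: s x => [|y s IH] x; first by left.
rewrite /= => /andP[xy ys] /andP[xs us].
have rcE z n : n < z -> rev (iota (z - n.+1) n.+2) = z :: rev (iota (z.-1 - n) n.+1).
  move=> nz; have -> : z.-1 - n = z - n.+1 by clear; lia.
  by rewrite -[n.+2]addn1 iotaD rev_cat subnK.
case: (IH y ys us) => [sE|[sy sE]]; case/orP: xy => /eqP xy.
- by left; rewrite sE xy.
- case: s {IH ys us} sE xs => [_ _|z s [zE _]].
    by right; rewrite xy subSS subn0; split.
  by rewrite !inE zE xy eqxx orbT.
- case: s {IH ys us} sE xs sy => [_ _ _|z s sE xs sy].
    by left; rewrite xy.
  have : x \in y :: z :: s by rewrite sE mem_rev mem_iota xy; move: sy; rewrite xy /=; move: (size s) => n; clear; lia.
  by rewrite inE => /orP[/eqP xy2|xz]; [clear -xy xy2; lia|rewrite inE xz orbT in xs].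
right; split; first by rewrite xy ltnS.
by rewrite rcE ?xy ?ltnS //= -sE.
Qed.

(** * Total dense paths as vertex sequences *)

Section TotalDensePaths.
Variables (V : finType) (e : rel V).
Hypothesis (esym : symmetric e).

Lemma gpathE p : gpath e p = [&& p != [::], sorted e p & uniq p].
Proof. by case: p. Qed.

Lemma mem_inner x0 (p : seq V) k : 0 < k -> k.+1 < size p -> nth x0 p k \in inner_vertices p.
Proof.
move=> k0 kp; have k1 : k.-1.+1 = k by rewrite prednK.
have -> : nth x0 p k = nth x0 (inner_vertices p) k.-1.
  by rewrite nth_behead k1 nth_take //; clear -kp; lia.
by rewrite mem_nth // size_behead size_takel ?leq_pred //; clear -kp k0; lia.
Qed.

Lemma infix_pair x0 (p : seq V) k : k.+1 < size p ->
  infix [:: nth x0 p k; nth x0 p k.+1] p.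
Proof.
move=> kp; rewrite -[X in infix _ X](cat_take_drop k p) infix_catl //.
by rewrite (drop_nth x0) ?(ltnW kp) // (drop_nth x0) // prefix_infix.
Qed.

Lemma is_total_dense_path_rev p : is_total_dense_path e p -> is_total_dense_path e (rev p).
Proof.
case=> + lp ip ep; rewrite gpathE => /and3P[p0 sp up].
have path_rev f : inr f \in path_elements e (rev p) -> inr f \in path_elements e p.
  rewrite !inE => /existsP[u /existsP[v /andP[uv fE]]].
  apply/existsP; exists v; apply/existsP; exists u.
  by rewrite setUC fE andbT -infix_rev.
split.
- rewrite gpathE rev_uniq up andbT -size_eq0 size_rev size_eq0 p0 rev_sorted /=.
  by rewrite (eq_sorted (e' := e)) // => x y; rewrite esym.
- by rewrite /path_length size_rev.
- move=> v; case: p lp ip {ep sp up p0 path_rev} => // x p; case/lastP: p => // p y _ ip vi.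
  apply: ip; move: vi; rewrite /inner_vertices rev_cons rev_rcons /= !size_rcons /= size_rev.
  by rewrite -!cats1 !take_size_cat ?size_rev // mem_rev.
- by move=> f /path_rev; exact: ep.
Qed.

(* Stated for booleans [p], so that no choice between extending [q] and stopping
   is needed. *)
Lemma total_dense_path_maximal (p : bool) q : is_total_dense_path e q ->
  (forall q', total_dense_path e q' -> infix q q' -> p) -> ~~ p -> False.
Proof.
have [n] := ubnP (#|V| - size q); elim: n q => // n IH q nq tq H np.
suff /H : total_dense_path e q by move/(_ (infix_refl _)); rewrite (negPf np).
split=> // q' tq' qq'; apply/eqP; apply: contraT => neq; exfalso.
have sq : size q < size q'.
  rewrite ltn_neqAle size_infix // andbT; apply: contraNneq neq => sE.
  by rewrite eq_sym -(size_subseq_leqif (infixW qq')) sE.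
apply: (IH q') => //; last by move=> q'' tq'' iq; apply: (H q'') => //; exact: infix_trans iq.
have : size q' <= #|V|.
  by case: tq'; rewrite gpathE => /and3P[_ _ /card_uniqP<-] *; exact: max_card.
clear -sq nq; lia.
Qed.
End TotalDensePaths.

(** * The dense elements of a caterpillar, read off its spine *)

Section SpineDegrees.
Variables (V : finType) (e : rel V) (x0 : V) (U : seq V) (r : nat).
Hypotheses (esym : symmetric e) (eirr : irreflexive e).
Hypotheses (uU : uniq U) (sU : size U = r.+2).
Hypothesis eU : {in U &, forall v w,
  e v w = (index w U == (index v U).+1) || (index v U == (index w U).+1)}.
Hypothesis eH : forall v, v \notin U ->
  exists w, [/\ w \in U, 0 < index w U <= r & forall x, e v x = (x == w)].
Local Notation m := (m_t e).
Hypothesis m6 : 6 <= m.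
Hypothesis dV : forall v, total_dense (inl v : element e) -> v \in U /\ 0 < index v U <= r.
Let u i := nth x0 U i.
Hypothesis dE : forall f : edge e, total_dense (inr f : element e) ->
  exists2 i, 0 < i < r & val f = [set u i; u i.+1].
Let L i := #|hanging e U i|.

Lemma degree_u i : 0 < i <= r -> degree e (u i) = L i + 2.
Proof.
case/andP=> i0 ir; have i1 : i.-1 <= r.+1 by clear -ir; lia.
have ir1 := leqW ir; have eui := spine_adj x0 uU sU eU ir1; have iu := index_u x0 uU sU.
have -> : degree e (u i) = #|[set u i.-1; u i.+1] :|: hanging e U i|.
  rewrite /degree; congr #|pred_of_set _|; apply/setP=> w; rewrite !inE.
  case: (boolP (w \in U)) => wU /=; rewrite ?orbF; last first.
    have [/andP[_ ar] aw] := anchorP x0 eH wU.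
    rewrite esym aw nth_uniq ?sU //; last by rewrite ltnS leqW.
    rewrite eq_sym; symmetry; rewrite orb_idl // => /orP[]/eqP wE.
      by rewrite wE mem_nth ?sU // in wU.
    by rewrite wE mem_nth ?sU // in wU.
  have wr := index_le sU wU; rewrite -(nth_index x0 wU) eui //.
  by rewrite !nth_uniq ?sU //; clear -i0; lia.
rewrite cardsU disjoint_setI0 ?cards0; last first.
  rewrite disjoint_subset; apply/subsetP=> w; rewrite !inE.
  by case/orP=> /eqP->; rewrite mem_nth ?sU.
by rewrite cards2 nth_uniq ?sU //; rewrite /L; clear -i0; lia.
Qed.

Lemma degree_leaf v : v \notin U -> degree e v = 1.
Proof.
move=> vU; have [_ av] := anchorP x0 eH vU.
rewrite /degree -(cards1 (u (anchor e U v))); congr #|pred_of_set _|.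
by apply/setP=> w; rewrite !inE av.
Qed.

Lemma dense_u i : 0 < i <= r -> total_dense (inl (u i) : element e) = (m - 5 <= (L i).*2).
Proof. by move=> ir; rewrite /total_dense tdeg_vertex // degree_u //; clear -m6; lia. Qed.

Lemma dense_e i (f : edge e) : 0 < i < r -> val f = [set u i; u i.+1] ->
  total_dense (inr f : element e) = (m - 5 <= L i + L i.+1).
Proof.
move=> ir fE; have eui : e (u i) (u i.+1).
  by rewrite (spine_adj x0 uU sU eU) ?eqxx //; clear -ir; lia.
rewrite /total_dense (tdeg_edge esym eirr eui fE) !degree_u; [|clear -ir; lia..].
by clear -m6; lia.
Qed.

(** A pendant edge at vertex [i] has total degree [L i + 3]; for larger [L i] it would be dense,
    against [dE]. *)
Lemma hang_le i : L i <= m - 5.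
Proof.
rewrite leqNgt; apply/negP=> Li.
have /card_gt0P[v] : 0 < L i by clear -Li; lia.
rewrite inE => /andP[vU /eqP va]; have [ir av] := anchorP x0 eH vU.
have vu : e v (u i) by rewrite av va eqxx.
have fE : val (mk_edge vu) = [set v; u i] by [].
have : total_dense (inr (mk_edge vu) : element e).
  rewrite /total_dense (tdeg_edge esym eirr vu fE) degree_leaf // degree_u -?va //.
  by rewrite va; clear -m6 Li; lia.
move/dE=> [j jr]; rewrite fE => vE; have : v \in [set u j; u j.+1] by rewrite -vE !inE eqxx.
by rewrite !inE => /orP[]/eqP vj; rewrite vj mem_nth ?sU // in vU; clear -jr; lia.
Qed.

Lemma total_dense_pair q k : is_total_dense_path e q -> k.+1 < size q ->
  exists i, [/\ 0 < i < r, m - 5 <= L i + L i.+1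
    & (nth x0 q k = u i /\ nth x0 q k.+1 = u i.+1) \/
      (nth x0 q k = u i.+1 /\ nth x0 q k.+1 = u i)].
Proof.
move=> [+ _ _ eq kq]; rewrite gpathE => /and3P[_ /(sortedP x0) sq uq].
have ab := sq k kq; set a := nth x0 q k in ab *; set b := nth x0 q k.+1 in ab *.
have tf : total_dense (inr (mk_edge ab) : element e).
  apply: eq; rewrite inE; apply/existsP; exists a; apply/existsP; exists b.
  by rewrite infix_pair /=.
have [i ir fE] := dE tf; exists i; split=> //; first by rewrite -(dense_e ir fE).
have nab : a != b by apply/eqP=> abE; have := sq k kq; rewrite -/a -/b abE eirr.
have : a \in [set u i; u i.+1] by rewrite -fE !inE eqxx.
have : b \in [set u i; u i.+1] by rewrite -fE !inE eqxx orbT.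
rewrite !inE => /orP[]/eqP bE /orP[]/eqP aE; [|by right|by left|];
  by rewrite aE bE eqxx in nab.
Qed.

Lemma total_dense_single i (ir : 0 < i < r) : m - 5 <= L i + L i.+1 ->
  is_total_dense_path e [:: u i; u i.+1].
Proof.
move=> Di; have eui : e (u i) (u i.+1).
  by rewrite (spine_adj x0 uU sU eU) ?eqxx //; clear -ir; lia.
split=> //.
  by rewrite gpathE /= eui !inE nth_uniq ?sU //; clear -ir; lia.
move=> f; rewrite inE => /existsP[a /existsP[b /andP[ab /eqP fE]]].
have abE : [:: a; b] = [:: u i; u i.+1].
  apply/eqP; have := mem_infix ab; have := infixW ab.
  by rewrite -(size_subseq_leqif (infixW ab)).
case: abE => aE bE; rewrite aE bE in fE; by rewrite (dense_e ir fE).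
Qed.

Lemma dense_interval : unique_total_dense_path e -> exists lo hi,
  [/\ 0 < lo, lo <= hi, hi < r,
      forall i, 0 < i < r -> (m - 5 <= L i + L i.+1) = (lo <= i <= hi)
    & forall i, lo < i <= hi -> m - 5 <= (L i).*2].
Proof.
case=> p [tp _] pu; have [gp lp _ _] := tp.
have sp : 1 < size p by move: lp; rewrite /path_length; clear; lia.
have /and3P[_ sop up] : [&& p != [::], sorted e p & uniq p] by rewrite -gpathE.
have inP v : v \in p -> v \in U.
  move=> vp; rewrite -(nth_index x0 vp); move: vp; rewrite -index_mem => ivp.
  have [kp|kp] := ltnP (index v p).+1 (size p).
    have [i [ir _ H]] := total_dense_pair tp kp.
    by case: H => -[-> _]; rewrite mem_nth // sU; clear -ir; lia.
  have kp2 : (index v p).-1.+1 < size p by case: (index v p) ivp.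
  have kE : (index v p).-1.+1 = index v p by case: (index v p) kp => //; rewrite leqNgt sp.
  have [i [ir _ H]] := total_dense_pair tp kp2.
  by case: H => -[_]; rewrite kE => ->; rewrite mem_nth // sU; clear -ir; lia.
(* By [unit_step_path] the spine indices increase along [p] or along its reversal. *)
have [p' [lo [tp' idx mp]]] : exists p' lo, [/\ is_total_dense_path e p',
    map (index^~ U) p' = iota lo (size p) & p' =i p].
  have uidx : uniq (map (index^~ U) p).
    by rewrite map_inj_in_uniq // => v w /inP vU /inP wU; exact: (index_inj x0).
  have sidx : sorted (fun i j => (j == i.+1) || (i == j.+1)) (map (index^~ U) p).
    apply/(sortedP 0) => k; rewrite size_map => kp.
    rewrite !(nth_map x0) ?(ltnW kp) //.
    have [i [ir _ H]] := total_dense_pair tp kp.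
    have i1 : i <= r.+1 by clear -ir; lia.
    have i2 : i.+1 <= r.+1 by clear -ir; lia.
    by case: H => -[-> ->]; rewrite !(index_u x0 uU sU) // eqxx ?orbT.
  move: uidx sidx (size_map (index^~ U) p); case E: (map _ p) => [|x s] us ss.
    by move=> s0; rewrite -s0 in sp.
  have [iE|[_ iE]] := unit_step_path ss us; move=> sE.
    by exists p, x; rewrite E -sE -iE.
  exists (rev p), (x - size s); split=> [||v]; last by rewrite mem_rev.
    exact: is_total_dense_path_rev.
  by rewrite map_rev E iE revK -sE.
have sp' : size p' = size p by rewrite -(size_map (index^~ U)) idx size_iota.
have p'u k : k < size p -> nth x0 p' k = u (lo + k).
  move=> kp; rewrite -[lo + k](nth_iota lo _ kp) -idx (nth_map x0) ?sp' //.
  by rewrite /u nth_index // inP // -mp mem_nth // sp'.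
have lor k : k < size p -> lo + k <= r.+1.
  move=> kp; rewrite -[lo + k](nth_iota lo _ kp) -idx (nth_map x0) ?sp' //.
  by rewrite (index_le sU) // inP // -mp mem_nth // sp'.
have pairs k : k.+1 < size p -> 0 < lo + k < r /\ m - 5 <= L (lo + k) + L (lo + k).+1.
  move=> kp; rewrite -sp' in kp; have [i [ir Di H]] := total_dense_pair tp' kp.
  rewrite sp' in kp; have k1 := ltnW kp.
  have i1 : i <= r.+1 by clear -ir; lia.
  have i2 : i.+1 <= r.+1 by clear -ir; lia.
  have uinj i' j' : i' <= r.+1 -> j' <= r.+1 -> u i' = u j' -> i' = j'.
    by move=> h1 h2 /eqP; rewrite nth_uniq ?sU // => /eqP.
  have [l1 l2] := (lor _ k1, lor _ kp).
  case: H => -[]; rewrite !p'u // => H1 H2.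
    by rewrite (uinj _ _ l1 i1 H1).
  by have := uinj _ _ l1 i2 H1; have := uinj _ _ l2 i1 H2; clear; lia.
(* The vertices have indices up to [lo + size p - 1]; [hi] is the left end of the last edge. *)
exists lo, (lo + size p - 2); split.
- by have [] := pairs 0 sp; clear; lia.
- by clear -sp; lia.
- have kp : (size p - 2).+1 < size p by clear -sp; lia.
  by have [] := pairs _ kp; clear -sp; lia.
- move=> i ir; apply/idP/idP => [Di|hi]; last first.
    have kp : (i - lo).+1 < size p by clear -hi sp; lia.
    have [_] := pairs _ kp; rewrite subnKC //; by case/andP: hi.
  (* A dense edge outside the interval would be a dense path by itself; a maximal extension of it
     would be [p] up to reversal and put the edge inside. *)
  apply: contraT => nin; exfalso.
  apply: (total_dense_path_maximal (total_dense_single ir Di) _ nin) => q tq iq.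
  have mem_p v : v \in q -> v \in p'.
    by rewrite mp; case/orP: (pu q tq) => /eqP->; rewrite ?mem_rev.
  have range j : j <= r.+1 -> u j \in p' -> lo <= j < lo + size p.
    move=> jr jp; have := map_f (index^~ U) jp.
    by rewrite idx (index_u x0 uU sU) // mem_iota.
  have h1 := range i _ (mem_p _ (mem_infix iq (mem_head _ _))).
  have h2 := range i.+1 _ (mem_p _ (mem_infix iq _)).
  have {}h1 := h1 _; have {}h2 := h2 _ _.
  have i1 : i <= r.+1 by clear -ir; lia.
  have i2 : i.+1 <= r.+1 by clear -ir; lia.
  have := h1 i1; have := h2 i2; rewrite !inE eqxx orbT => /(_ isT).
  by clear -sp; lia.
move=> i hi; have [_ _ ip' _] := tp'.
have k0 : 0 < i - lo by clear -hi; lia.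
have kp : (i - lo).+1 < size p' by rewrite sp'; clear -hi sp; lia.
have := ip' _ (mem_inner x0 k0 kp); rewrite p'u; last by rewrite -sp'; exact: ltnW.
have kp2 : (size p - 2).+1 < size p by clear -sp; lia.
have ir : 0 < i <= r by have [] := pairs _ kp2; clear -sp hi; lia.
by rewrite subnKC ?dense_u //; clear -hi; lia.
Qed.

(** At least [m] elements are dense by [m_t_le]. Their positions on the line are distinct, and lie
    either on the dense path without its non-dense ends or at the other dense vertices. *)
Lemma dense_count lo hi : 0 < lo -> lo <= hi -> hi < r ->
  (forall i, 0 < i < r -> (m - 5 <= L i + L i.+1) = (lo <= i <= hi)) ->
  m <= (hi.*2.+1 + (m - 5 <= (L hi.+1).*2)).+1 - (lo.*2 + ~~ (m - 5 <= (L lo).*2))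
    + size [seq i <- iota 1 r | (m - 5 <= (L i).*2) && ~~ (lo <= i <= hi.+1)].
Proof.
move=> lo0 lohi hir DeP; set A0 := lo.*2 + _; set B0 := hi.*2.+1 + _; set I := filter _ _.
pose pos (x : element e) := match x with
  | inl v => (index v U).*2 | inr f => \sum_(v in val f) index v U end.
have posE i (f : edge e) : i < r -> val f = [set u i; u i.+1] -> pos (inr f) = i.*2.+1.
  move=> ir fE; have i1 : i <= r.+1 by clear -ir; lia.
  have i2 : i.+1 <= r.+1 by clear -ir; lia.
  rewrite /pos fE big_setU1 ?big_set1 /= ?(index_u x0 uU sU) //; first by clear; lia.
  by rewrite inE nth_uniq ?sU //; clear; lia.
have cases x : total_dense x -> pos x \in iota A0 (B0.+1 - A0) ++ map double I.
  case: x => [v|f] tx; rewrite mem_cat mem_iota.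
    have [vU vr] := dV tx; move: tx; rewrite -(nth_index x0 vU) dense_u //= => Dv.
    rewrite index_uniq ?index_mem //; set i := index v U in vr Dv *.
    case: (boolP (lo <= i <= hi.+1)) => il; last first.
      by rewrite orbC map_f // mem_filter Dv il mem_iota; clear -vr; lia.
    apply/orP; left; suff : A0 <= i.*2 <= B0 by clear; lia.
    rewrite /A0 /B0; apply/andP; split.
      have [iE|iE] := eqVneq i lo; first by rewrite -iE Dv addn0.
      by clear -il iE; case: (_ <= (L lo).*2); lia.
    have [iE|iE] := eqVneq i hi.+1; first by rewrite -iE Dv iE; clear; lia.
    by clear -il iE; case: (_ <= (L hi.+1).*2); lia.
  have [i ir fE] := dE tx; have i1 : i < r by case/andP: ir.
  move: tx; rewrite (dense_e ir fE) DeP // (posE _ _ i1 fE) => il; apply/orP; left.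
  rewrite /A0 /B0; clear -il; case: (_ <= (L lo).*2); case: (_ <= (L hi.+1).*2); lia.
have inj : {in high_elements e (m - 1) &, injective pos}.
  move=> x y; rewrite !inE => tx ty.
  case: x y tx ty => [v|f] [w|g] tx ty.
  - have [vU _] := dV tx; have [wU _] := dV ty.
    by move=> /double_inj vw; rewrite -(nth_index x0 vU) vw nth_index.
  - have [i /andP[_ ir] gE] := dE ty; rewrite (posE _ _ ir gE) /=; clear; lia.
  - have [i /andP[_ ir] gE] := dE tx; rewrite (posE _ _ ir gE) /=; clear; lia.
  - have [i /andP[_ ir] fE] := dE tx; have [j /andP[_ jr] gE] := dE ty.
    rewrite (posE _ _ ir fE) (posE _ _ jr gE) => ij; congr inr; apply: val_inj.
    by rewrite fE gE (_ : i = j) //; clear -ij; lia.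
apply: leq_trans (m_t_le e) _; rewrite cardE -(size_map pos).
rewrite -[B0.+1 - A0](size_iota A0) -(size_map double I) -size_cat.
apply: uniq_leq_size.
  by rewrite map_inj_in_uniq ?enum_uniq // => x y; rewrite !mem_enum; exact: inj.
by move=> j /mapP[x]; rewrite mem_enum inE => tx ->; exact: cases.
Qed.

Lemma phi_t_spine : unique_total_dense_path e -> phi_t e = m.
Proof.
move=> hone; apply/eqP; rewrite eqn_leq phi_t_le /=.
have [lo [hi [lo0 lohi hir DeP DvP]]] := dense_interval hone.
have cm : #|[set: 'I_m]| = m by rewrite cardsT card_ord.
have [|||||c [F [cp cF cw]]] := @interval_colouring 'I_m L r lo hi _ _ lo0 lohi hir.
- by rewrite cm.
- by move=> i; rewrite cm; exact: hang_le.
- by rewrite cm.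
- by rewrite cm.
- by rewrite cm; exact: dense_count.
rewrite cm in cw.
apply: (phi_t_ge (c := [ffun x => spine_colour U c F x])).
  by apply: leq_trans (m_t_le e) (max_card _).
exact: (spine_b_colouring x0 esym uU sU eU eH m6 cp cF cw).
Qed.
End SpineDegrees.

Theorem theorem5 (V : finType) (e : rel V) (P : seq V)
    (hG : simple_graph e)
    (hT : caterpillar e P)
    (hm : 6 <= m_t e)
    (hpiv : ~ total_pivoted e P)
    (hP : forall x : element e, total_dense x -> x \in path_elements e P)
    (hone : unique_total_dense_path e) :
  phi_t e = m_t e.
Proof.
have [symE irrE] := hG.
have edgeP (f : edge e) : total_dense (inr f : element e) ->
    exists a b, [/\ a \in P, b \in P & val f = [set a; b]].
  move=> /hP; rewrite inE => /existsP[a /existsP[b /andP[ab /eqP fE]]].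
  by exists a, b; rewrite !(mem_infix ab) ?inE ?eqxx ?orbT.
(* The dense path has an edge, which is dense, so its two distinct ends lie in [P]. *)
have sP : 1 < size P.
  have [[|x [|y q]] [[gq lq _ eq] _] _] := hone => //.
  have xy : e x y by case/andP: gq => /andP[].
  have [|a [b [aP bP fE]]] := edgeP (mk_edge xy).
    apply: eq; rewrite inE; apply/existsP; exists x; apply/existsP; exists y.
    by rewrite eqxx andbT (prefix_infix [:: x; y]).
  have : #|[set x; y]| <= size P.
    rewrite [[set x; y]]fE; apply: leq_trans (card_size P); apply: subset_leq_card.
    by apply/subsetP=> z; rewrite !inE => /orP[]/eqP->.
  by rewrite cards2; case: eqP => // xyE; have := xy; rewrite xyE irrE.
have [U [uU sU eU eH UP]] := caterpillar_spine symE irrE hT sP.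
have [x0 _] : exists x0, x0 \in P by case: P sP {hT hpiv hP edgeP eH UP sU} => // x s _; exists x; exact: mem_head.
apply: (@phi_t_spine V e x0 U (size P)) => //.
  by move=> v /hP; rewrite inE UP => /andP.
(* A pendant edge has an end off [P]. For a spine edge both end indices lie between 1 and [size P],
   whence [0 < i < size P]. *)
move=> f /edgeP[a [b [aP bP fE]]].
have fP z : z \in val f -> z \in P by rewrite fE !inE => /orP[]/eqP->.
have [[i ir fi]|[v vU fv]] := edge_cases x0 symE sU eU eH f; last first.
  by have := fP v; rewrite fv !inE eqxx UP (negPf vU) => /(_ isT).
exists i => //; have := fP (nth x0 U i); have := fP (nth x0 U i.+1).
have i1 : i <= (size P).+1 by exact: leqW.
have i2 : i.+1 <= (size P).+1 by [].
rewrite fi !inE !eqxx orbT !UP !(index_u x0 uU sU) //.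
by move=> /(_ isT)/and3P[_ _ h1] /(_ isT)/and3P[_ h2 _]; rewrite h2.
Qed.
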